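(* For every $k_2\in[0,1]$, the simplified ePBS game (with value distribution $F$ and delayed canonicalization probability $k_2$) admits a symmetric uni-pooling perfect Bayesian equilibrium. Let $A_F(v):=\int_0^vF(t)\,dt$ and $K_F^+:=1/(1+A_F(1))$. (i) If $0\le k_2<K_F^+$, then the set $\mathcal C_F(k_2)$ of admissible cutoffs is nonempty. Moreover, for every $c\in\mathcal C_F(k_2)$, the first-stage rule $$s^F_{k_2,c}(v)=\begin{cases}0,& v<c,\\[1mm] v-\dfrac{A_F(v)-(1-k_2)A_F(c)}{F(v)},& v\ge c\end{cases}$$ can be completed into a PBE. On path, the proposer chooses CTN at the $(0,0)$ stage-1 bid history and chooses STOP at every history with at least one positive on-branch first-stage bid. When $c=0$, the second line of the formula is understood for $v>0$, and $s^F_{k_2,0}(0)=0$. (ii) If $K_F^+\le k_2\le1$, then there exists a degenerate full-pooling PBE: all builders bid $0$ at stage 1, the proposer chooses CTN after the zero-zero history, and the stage-2 continuation is the standard two-builder first-price auction under the prior $F$.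
   Context: Simplified ePBS game. There are a proposer and two fast builders with values i.i.d. from $F$ on $[0,1]$, where $F$ is atomless, continuous, strictly increasing on $[0,1]$, continuously differentiable on $(0,1)$, and has positive density on $(0,1)$. Each builder $i$ privately observes $v_i$ and submits a signed stage-1 bid $b_{i,1}\in\mathbb R_+$. The proposer observes both stage-1 bids and chooses STOP or CTN (her only choice). After STOP, the higher stage-1 bidder wins and pays its bid (terminal stage $t=1$). After CTN, both stage-1 bids are publicly broadcast, each builder submits a stage-2 bid $b_{i,2}\ge b_{i,1}$, and the higher stage-2 bidder wins and pays its stage-2 bid ($t=2$). Ties are broken symmetrically. Payoffs: builder $i$ gets $k_t(v_i-b_{i,t})\mathbf 1\{i\text{ wins}\}$, the proposer gets $k_t\max_ib_{i,t}$, with $k_1=1$ and $k_2\in[0,1]$. Perfect Bayesian equilibrium (PBE): builders and the proposer (in her stopping choice) are sequentially rational at every information set given beliefs; beliefs follow Bayes' rule on path and are arbitrary feasible beliefs off path. Regular uni-pooling rule. A symmetric stage-1 bid rule $s$ is regular uni-pooling with cutoff $c\in[0,1]$ if $s(v)=0$ for every $v<c$, $s(v)>0$ for every $v\in(c,1]$, the positive branch is strictly increasing and continuously differentiable on $(c,1]$, and $0\le s(v)\le v$ on path. (The cutoff type itself is payoff-irrelevant and may be assigned to either branch.) A uni-pooling PBE is a PBE whose stage-1 rule is of this form; full pooling is the degenerate case $c=1$. Cutoff-admissibility. For $c\in[0,1)$, write $c\in\mathcal C_F(k_2)$ if $$A_F(u)\le(1-k_2)\bigl[uF(u)+A_F(c)\bigr]\quad\forall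 u\in[c,1],\qquad\text{and}\qquad d_F(c)\le k_2,$$ where $d_F(c):=c-\dfrac{k_2A_F(c)}{F(c)}$ for $c>0$ and $d_F(0):=0$.
   Formalization: The positive branch is shown continuously differentiable on (c,1) and continuous on (c,1]; differentiability at the endpoint 1 is claimed only when F is one-sided continuously differentiable at 1, since otherwise it fails (e.g. F(v)=1−√(1−v), k_2=0). *)

(* Defs.v *)
(* MathComp-Analysis development over an abstract [R : realType]. *)
From HB Require Import structures.
From mathcomp Require Import all_boot all_order all_algebra.
From mathcomp Require Import all_classical all_reals all_analysis.
From mathcomp Require Import measurable_realfun.

Set Implicit Arguments.
Unset Strict Implicit.
Unset Printing Implicit Defensive.

Import Order.TTheory GRing.Theory Num.Theory.
Import numFieldNormedType.Exports.

Local Open Scope classical_set_scope.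
Local Open Scope ring_scope.

Section ValueDistribution.
Context {R : realType}.
Implicit Types (P : probability (measurableTypeR R) R) (g : R -> R).
Implicit Types u v w x y c : R.

Definition unit_itv : set (measurableTypeR R) := `[0, 1]%classic.

(* [F], as a real-valued function, when [P] is the law of one value. *)
Definition cdfF P (x : R) : R := fine (P `]-oo, x]%classic).

Definition C1_on_oo g (a b : R) : Prop :=
  forall x, a < x < b -> derivable g x 1 /\ {for x, continuous (derive1 g)}.

(* One-sided C^1 regularity at the right endpoint [b] of an interval. *)
Definition C1_at_left g (b : R) : Prop :=
  exists l : R, (g x - g b) / (x - b) @[x --> b^'-] --> l /\
                derive1 g x @[x --> b^'-] --> l.

Definition value_distribution P : Prop :=
  [/\ P unit_itv = 1%E /\ (forall x : R, P [set x] = 0%E),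
      {within `[0, 1]%classic, continuous (cdfF P)},
      forall x y, 0 <= x -> x < y -> y <= 1 -> cdfF P x < cdfF P y,
      C1_on_oo (cdfF P) 0 1
    & forall x, 0 < x < 1 -> 0 < derive1 (cdfF P) x].

Definition AF P (v : R) : R :=
  (\int[lebesgue_measure]_(t in `[0, v]%classic) cdfF P t)%R.

Definition Kplus P : R := (1 + AF P 1)^-1.

Definition dF P (k2 c : R) : R :=
  if c == 0 then 0 else c - k2 * AF P c / cdfF P c.

Definition admissible_cutoff P (k2 c : R) : Prop :=
  [/\ 0 <= c < 1,
      forall u, c <= u <= 1 ->
        AF P u <= (1 - k2) * (u * cdfF P u + AF P c)
    & dF P k2 c <= k2].

Definition sF P (k2 c v : R) : R :=
  if (v < c) || (v == 0) then 0
  else v - (AF P v - (1 - k2) * AF P c) / cdfF P v.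

(* Smoothness of the positive branch is two-sided C^1 on the open interval
   ]c, 1[ and continuity on ]c, 1].  One-sided C^1 regularity at the endpoint 1
   is demanded exactly when [F] has it: [F] is only assumed C^1 on ]0, 1[, and
   if its density is unbounded at 1 so is the slope of the equilibrium bids. *)
Definition regular_uni_pooling P (s : R -> R) (c : R) : Prop :=
  [/\ 0 <= c <= 1 /\ (forall v, 0 <= v -> v < c -> s v = 0),
      forall v, c < v <= 1 -> 0 < s v,
      forall v w, c < v -> v < w -> w <= 1 -> s v < s w,
      [/\ {within `]c, 1]%classic, continuous s}, C1_on_oo s c 1
        & c < 1 -> C1_at_left (cdfF P) 1 -> C1_at_left s 1]
    & forall v, 0 <= v <= 1 -> 0 <= s v <= v].

End ValueDistribution.

Section Game.
Context {R : realType}.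
Implicit Type P : probability (measurableTypeR R) R.
Implicit Types v w x b : R.

(* Builders are [false] and [true]; [~~ i] is the rival of [i].  Strategies are
   pure.  Values and bids are reals, but only values in [0, 1] and nonnegative
   bids matter. *)
Record assessment := Assessment {
  (* builder, value |-> stage-1 bid *)
  bid1 : bool -> R -> R;
  (* stage-1 bids of builders [false], [true]; [true] means STOP *)
  stop : R -> R -> bool;
  (* builder, value, own stage-1 bid, rival's stage-1 bid |-> stage-2 bid *)
  bid2 : bool -> R -> R -> R -> R;
  (* proposer, given the bids of [false], [true]: belief on their values *)
  proposer_belief :
    R -> R -> probability (measurableTypeR R * measurableTypeR R)%type R;
  (* builder, value, own stage-1 bid, rival's stage-1 bid, after CTN:
     belief on the rival's value *)
  builder_belief :
    bool -> R -> R -> R -> probability (measurableTypeR R) R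
}.

Implicit Types a : assessment.

(* The proposer's decision, seen from builder [i]. *)
Definition stops a (i : bool) (own other : R) : bool :=
  if i then stop a other own else stop a own other.

(* Winning probability of bid [x] against [y]. *)
Definition win (x y : R) : R :=
  if y < x then 1 else if x == y then 2^-1 else 0.

Definition feasible a : Prop :=
  [/\ forall i, measurable_fun unit_itv (bid1 a i : measurableTypeR R -> R),
      forall i v, 0 <= v <= 1 -> 0 <= bid1 a i v,
      measurable_fun setT
        (fun x : measurableTypeR R * measurableTypeR R => stop a x.1 x.2),
      forall i, measurable_fun setT
        (fun x : measurableTypeR R * measurableTypeR R * measurableTypeR R =>
           bid2 a i x.1.1 x.1.2 x.2)
    & forall i v b b', 0 <= v <= 1 -> 0 <= b -> 0 <= b' -> b <= bid2 a i v b b'].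

(* Interim payoff of type [v] of builder [i] from bidding [b] at stage 1 and
   [p b'] at stage 2 after observing the rival's stage-1 bid [b']. *)
Definition stage1_payoff P k2 a (i : bool) (v b : R) (p : R -> R) : \bar R :=
  (\int[P]_(w in unit_itv)
     (let b' := bid1 a (~~ i) w in
      if stops a i b b' then (v - b) * win b b'
      else k2 * ((v - p b') * win (p b') (bid2 a (~~ i) w b' b)))%:E)%E.

Definition stage2_payoff (k2 : R) a (i : bool) (v b b' x : R) : \bar R :=
  (\int[builder_belief a i v b b']_(w in unit_itv)
     (k2 * ((v - x) * win x (bid2 a (~~ i) w b' b)))%:E)%E.

Definition ctn_revenue (k2 : R) a (b0 b1 : R) : \bar R :=
  (\int[proposer_belief a b0 b1]_(x in unit_itv `*` unit_itv)
     (k2 * Num.max (bid2 a false x.1 b0 b1) (bid2 a true x.2 b1 b0))%:E)%E.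

Definition stage1_rational P (k2 : R) a : Prop :=
  forall i v b (p : R -> R), 0 <= v <= 1 -> 0 <= b ->
    measurable_fun setT (p : measurableTypeR R -> R) ->
    (forall b', 0 <= b' -> b <= p b') ->
    (stage1_payoff P k2 a i v b p <=
     stage1_payoff P k2 a i v (bid1 a i v) (bid2 a i v (bid1 a i v)))%E.

Definition proposer_rational (k2 : R) a : Prop :=
  forall b0 b1, 0 <= b0 -> 0 <= b1 ->
    if stop a b0 b1 then (ctn_revenue k2 a b0 b1 <= (Num.max b0 b1)%:E)%E
    else ((Num.max b0 b1)%:E <= ctn_revenue k2 a b0 b1)%E.

Definition stage2_rational (k2 : R) a : Prop :=
  forall i v b b' x, 0 <= v <= 1 -> 0 <= b -> 0 <= b' -> b <= x ->
    (stage2_payoff k2 a i v b b' x <=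
     stage2_payoff k2 a i v b b' (bid2 a i v b b'))%E.

(* [nu b] is the posterior on a value drawn from [P] once the bid [b] of a
   builder using rule [s] is observed: a regular conditional distribution given
   [s], required moreover to be carried by the types that bid [b], for every
   [b] in the range of [s], including those of probability zero. *)
Definition bayes_posterior P (s : R -> R)
    (nu : R -> probability (measurableTypeR R) R) : Prop :=
  [/\ forall A : set (measurableTypeR R), measurable A ->
        measurable_fun unit_itv
          ((fun v => nu (s v) A) : measurableTypeR R -> \bar R),
      forall A B : set (measurableTypeR R), measurable A -> measurable B ->
        P (unit_itv `&` A `&` s @^-1` B) =
        (\int[P]_(v in unit_itv `&` s @^-1` B) nu (s v) A)%E
    & forall v, 0 <= v <= 1 ->
        nu (s v) (unit_itv `&` s @^-1` [set s v]) = 1%E].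

Definition on_path_bid a (i : bool) (b : R) : Prop :=
  exists2 v, 0 <= v <= 1 & b = bid1 a i v.

Definition feasible_beliefs a : Prop :=
  (forall b0 b1, 0 <= b0 -> 0 <= b1 ->
     proposer_belief a b0 b1 (unit_itv `*` unit_itv) = 1%E) /\
  (forall i v b b', 0 <= v <= 1 -> 0 <= b -> 0 <= b' ->
     builder_belief a i v b b' unit_itv = 1%E).

(* A builder's stage-2 information set contains its own value and stage-1 bid;
   it is on path when that bid is the prescribed one, the rival's bid is a
   prescribed one, and the proposer is prescribed to continue. *)
Definition bayes_on_path P a : Prop :=
  exists nu : bool -> R -> probability (measurableTypeR R) R,
    [/\ forall i, bayes_posterior P (bid1 a i) (nu i),
        forall b0 b1, on_path_bid a false b0 -> on_path_bid a true b1 ->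
          forall A B : set (measurableTypeR R), measurable A -> measurable B ->
            proposer_belief a b0 b1 (A `*` B) =
            (nu false b0 A * nu true b1 B)%E
      & forall i v b', 0 <= v <= 1 -> on_path_bid a (~~ i) b' ->
          ~~ stops a i (bid1 a i v) b' ->
          forall A : set (measurableTypeR R), measurable A ->
            builder_belief a i v (bid1 a i v) b' A = nu (~~ i) b' A].

Definition PBE P (k2 : R) a : Prop :=
  [/\ feasible a,
      [/\ stage1_rational P k2 a, proposer_rational k2 a
        & stage2_rational k2 a],
      feasible_beliefs a
    & bayes_on_path P a].

(* Invariance of the strategy profile under exchange of the builders. *)
Definition symmetric_profile a : Prop :=
  [/\ forall v, 0 <= v <= 1 -> bid1 a false v = bid1 a true v,
      forall v b b', 0 <= v <= 1 -> 0 <= b -> 0 <= b' ->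
        bid2 a false v b b' = bid2 a true v b b'
    & forall b b', 0 <= b -> 0 <= b' -> stop a b b' = stop a b' b].

Definition uni_pooling_PBE P (k2 : R) a (c : R) : Prop :=
  [/\ PBE P k2 a, symmetric_profile a
    & forall i, regular_uni_pooling P (bid1 a i) c].

(* The standard (undelayed) first-price auction between two bidders with values
   drawn independently from [P], and its symmetric Bayes-Nash equilibria. *)
Definition fpa_payoff P (beta : R -> R) (v x : R) : \bar R :=
  (\int[P]_(w in unit_itv) ((v - x) * win x (beta w))%:E)%E.

Definition fpa_equilibrium P (beta : R -> R) : Prop :=
  [/\ measurable_fun unit_itv (beta : measurableTypeR R -> R),
      forall v, 0 <= v <= 1 -> 0 <= beta v
    & forall v x, 0 <= v <= 1 -> 0 <= x ->
        (fpa_payoff P beta v x <= fpa_payoff P beta v (beta v))%E].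

(* The equilibrium bid E[w | w <= v], in integrated-by-parts form. *)
Definition fpa_bid P (v : R) : R :=
  if v == 0 then 0 else v - AF P v / cdfF P v.

End Game.

Arguments assessment : clear implicits.

(* Main.v *)
(* With [A] the primitive of the cdf [F], everything rests on the convexity
   inequality [A y + (v - y) F y <= A v].  In the profile with cutoff [c], a
   pooling type [v] earns [k2 * A v] and a separating one
   [A v - (1 - k2) * A c], and a deviation that wins against exactly the types
   below [w] earns at most [(v - w) F w] plus the rent of type [w], hence no
   more than that.  The two admissibility conditions make the proposer stop on
   path ([k2 * u <= s u]) and, as [dF c <= k2], let her continue on the off-path
   bids below [dF c], which would otherwise undercut the lowest separating bid.
   Full pooling is the same profile with [c = 1], where [dF 1 <= k2] reads
   [Kplus <= k2]. *)
Require Import Defs.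
From HB Require Import structures.
From mathcomp Require Import all_boot all_order all_algebra.
From mathcomp Require Import all_classical all_reals all_analysis.
From mathcomp Require Import measurable_realfun.
From mathcomp Require Import ring lra.

Import Order.TTheory GRing.Theory Num.Theory.
Import numFieldNormedType.Exports.
Local Open Scope classical_set_scope.
Local Open Scope ring_scope.

(** A deviation, with its ties and its arbitrary stage-2 reply, is handled without locating the
    marginal rival that it beats. Each payoff is a constant times the expectation of some [g], the
    probability of winning against a given type. If it exceeded the bound, continuity of [F] would
    supply a type [w] at which the constant times [F w] already exceeds it; some type above [w]
    would then still be beaten or tied, and the convexity inequality at that type refutes this. For
    the prescribed bids a lower bound is enough: they beat all lower types, and ties are null. The
    weight [1 - k2] on [A c] makes the two rent formulas agree at [c], so [dF c] is the bid at which
    the cutoff type is indifferent between separating and pooling. Conditioning on the pool only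
    divides [F] and its primitive by [F c], hence one auction bid serves the prior and all its
    truncations. The delicate cases are the null pool of [c = 0] and type [1] under full pooling. *)

(** * Distribution functions of arbitrary laws *)

Section Cdf.
Context {R : realType} (Q : probability (measurableTypeR R) R).
Implicit Types x y t : R.

Lemma EFin_cdfF x : (cdfF Q x)%:E = Q `]-oo, x]%classic.
Proof. by rewrite /cdfF fineK// fin_num_measure. Qed.

Lemma cdfF_homo : {homo cdfF Q : x y / x <= y}.
Proof.
move=> x y xy; rewrite -lee_fin !EFin_cdfF; apply: le_measure.
- by rewrite inE; exact: measurable_itv.
- by rewrite inE; exact: measurable_itv.
- by move=> z /=; rewrite !in_itv/= => /le_trans; exact.
Qed.

Lemma cdfF_ge0 x : 0 <= cdfF Q x.
Proof. by rewrite -lee_fin EFin_cdfF. Qed.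

Lemma cdfF_le1 x : cdfF Q x <= 1.
Proof. by rewrite -lee_fin EFin_cdfF probability_le1. Qed.

Lemma measurable_cdfF D : measurable D ->
  measurable_fun D (cdfF Q : measurableTypeR R -> R).
Proof. by move=> mD; apply: nondecreasing_measurable => //; exact: cdfF_homo. Qed.

Lemma measurable_unit_itv : measurable (@unit_itv R).
Proof. exact: measurable_itv. Qed.

Lemma probability_carrier (S B : set (measurableTypeR R)) :
  measurable S -> measurable B -> Q S = 1%E -> Q (B `&` S) = Q B.
Proof.
move=> mS mB QS.
have QC : Q (~` S) = 0%E by rewrite probability_setC// QS subee.
have mSC : measurable (~` S) by exact: measurableC.
have QBC : Q (B `&` ~` S) = 0%E.
  apply/eqP; rewrite eq_le measure_ge0 andbT -QC.
  by apply: le_measure; rewrite ?inE//; exact: measurableI.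
rewrite -[in RHS](setIT B) -(setUv S) setIUr measureU ?[X in (_ + X)%E]QBC ?adde0//.
- exact: measurableI.
- exact: measurableI.
- by rewrite setIACA setICr setI0.
Qed.

End Cdf.

(** * The value distribution and the convex primitive of its cdf *)

Section Distribution.
Context {R : realType} (P : probability (measurableTypeR R) R).
Hypothesis hP : value_distribution P.
Implicit Types x y u v w c t : R.
Local Notation F := (cdfF P).
Local Notation A := (AF P).
Local Notation mu := (@lebesgue_measure R).

Lemma cdfF_cont : {within `[0, 1]%classic, continuous F}.
Proof. by case: hP. Qed.

Lemma cdfF_lt x y : 0 <= x -> x < y -> y <= 1 -> F x < F y.
Proof. by case: hP => _ _ + _ _; exact. Qed.

Lemma cdfF0 : F 0 = 0.
Proof.
case: hP => -[P1 Pa] _ _ _ _; rewrite /cdfF.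
rewrite -(probability_carrier P unit_itv _ _ _ P1); try exact: measurable_itv.
rewrite (_ : _ `&` _ = [set 0]) ?Pa//.
apply/seteqP; split=> z /=; rewrite /unit_itv /= !in_itv/=.
  by case=> z0 /andP[z0' _]; apply/eqP; rewrite eq_le z0 z0'.
by move=> ->; rewrite lexx ler01.
Qed.

Lemma cdfF1 : F 1 = 1.
Proof.
case: hP => -[P1 Pa] _ _ _ _; apply/eqP; rewrite eq_le cdfF_le1/=.
rewrite -lee_fin EFin_cdfF -P1; apply: le_measure; rewrite ?inE; try exact: measurable_itv.
by move=> z; rewrite /unit_itv /= !in_itv/= => /andP[].
Qed.

Lemma cdfF_gt0 v : 0 < v <= 1 -> 0 < F v.
Proof. by move=> /andP[v0 v1]; rewrite -cdfF0; exact: cdfF_lt. Qed.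

Lemma cdfF_le_inj x y : 0 <= x <= 1 -> 0 <= y <= 1 -> F x < F y -> x < y.
Proof.
move=> x01 y01; apply: contraTT; rewrite -!leNgt => yx; exact: cdfF_homo.
Qed.

Lemma cdfF_surj t : 0 <= t <= 1 -> exists2 w, 0 <= w <= 1 & F w = t.
Proof.
move=> t01; have : Num.min (F 0) (F 1) <= t <= Num.max (F 0) (F 1).
  by rewrite cdfF0 cdfF1 min_l ?max_r ?ler01.
move=> /(@IVT R F 0 1 t ler01 cdfF_cont)[w].
by rewrite in_itv/= => w01 <-; exists w.
Qed.

Lemma cdfF_integrable (B : set R) : measurable B -> (mu B < +oo)%E ->
  mu.-integrable B (EFin \o F).
Proof.
move=> mB Bfin; apply: measurable_bounded_integrable => //.
  exact: (@measurable_cdfF R P B mB).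
exists 1; split=> [|M M1 x _ /=]; first exact: num_real.
by rewrite ger0_norm ?cdfF_ge0// (le_trans (cdfF_le1 _ _))// ltW.
Qed.

(** On []y, v]] the monotone [F] lies between its two end values. The left half is the tangent
    inequality at [y], the right half the one at [v]; together they give convexity on both sides of
    the base point. *)
Lemma AF_bounds y v : 0 <= y -> y <= v ->
  (v - y) * F y <= A v - A y <= (v - y) * F v.
Proof.
move=> y0 yv; rewrite /AF Rintegral_itvB ?bnd_simp//; last first.
  apply: cdfF_integrable; first exact: measurable_itv.
  by rewrite /= lebesgue_measure_itv/=; case: ifP => _; rewrite ?ltry// -EFinB ltry.
have mI : measurable (`]y, v]%classic : set R) by exact: measurable_itv.
have fI : (mu (`]y, v]%classic : set R) < +oo)%E.
  by rewrite /= lebesgue_measure_itv/=; case: ifP => _; rewrite ?ltry// -EFinB ltry.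
have fE : fine (mu (`]y, v]%classic : set R)) = v - y.
  rewrite /= lebesgue_measure_itv/= lte_fin; case: ifPn => [yv'|]; first by [].
  by rewrite -leNgt => vy; rewrite [v](@le_anti _ _ v y) ?vy ?yv// subrr.
have iC r : mu.-integrable (`]y, v]%classic : set R) (EFin \o cst r).
  apply: measurable_bounded_integrable => //.
  exists `|r|; split=> [|M M1 x _ /=]; first exact: num_real.
  exact: ltW.
have cE r : (v - y) * r = \int[mu]_(_ in `]y, v]%classic) r.
  by rewrite Rintegral_cst// mulrC -fE.
rewrite !cE; apply/andP; split.
- apply: le_Rintegral => //; [exact: iC|exact: cdfF_integrable|].
  by move=> x /=; rewrite in_itv/= => /andP[/ltW yx _]; exact: cdfF_homo.
- apply: le_Rintegral => //; [exact: cdfF_integrable|exact: iC|].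
  by move=> x /=; rewrite in_itv/= => /andP[_ xv]; exact: cdfF_homo.
Qed.

Lemma AF0 : A 0 = 0.
Proof. by rewrite /AF set_itv1 Rintegral_set1. Qed.

Lemma AF_homo y v : 0 <= y -> y <= v -> A y <= A v.
Proof.
move=> y0 yv; have /andP[+ _] := AF_bounds y v y0 yv.
have := mulr_ge0 (_ : 0 <= v - y) (cdfF_ge0 P y); rewrite subr_ge0 => /(_ yv).
lra.
Qed.

Lemma AF_ge0 v : 0 <= v -> 0 <= A v.
Proof. by move=> v0; rewrite -AF0; exact: AF_homo. Qed.

Lemma AF_convex y v : 0 <= y -> 0 <= v -> A y + (v - y) * F y <= A v.
Proof.
move=> y0 v0; case: (leP y v) => [yv|/ltW vy].
  by have := AF_bounds y v y0 yv; lra.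
by have := AF_bounds v y v0 vy; lra.
Qed.

Lemma AF_strict_convex y v : 0 <= y -> y < v -> v <= 1 ->
  A v - A y < (v - y) * F v.
Proof.
(* Splitting at the midpoint gains strictness: the left half is compared with [F m], which is
   strictly below [F v]. *)
move=> y0 yv v1; pose m := (y + v) / 2.
have ym : y < m by rewrite /m; lra.
have mv : m < v by rewrite /m; lra.
have /andP[_ b1] := AF_bounds y m y0 (ltW ym).
have /andP[_ b2] := AF_bounds m v (le_trans y0 (ltW ym)) (ltW mv).
have := cdfF_lt m v (le_trans y0 (ltW ym)) mv v1; nra.
Qed.

Lemma AF_lt v : 0 < v <= 1 -> A v < v * F v.
Proof.
by move=> /andP[v0 v1]; have := AF_strict_convex 0 v (lexx _) v0 v1; rewrite AF0 !subr0.
Qed.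

Lemma AF_le v : 0 <= v <= 1 -> A v <= v * F v.
Proof.
move=> /andP[v0 v1]; have /andP[_] := AF_bounds 0 v (lexx _) v0.
by rewrite AF0 !subr0.
Qed.

Lemma AF_cont : {within `[0, 1]%classic, continuous A}.
Proof.
apply: (parameterized_integral_continuous (f := F)); first exact: ler01.
apply: cdfF_integrable; first exact: measurable_itv.
by rewrite /= lebesgue_measure_itv/= lte_fin ltr01 -EFinB ltry.
Qed.

Lemma AF_is_derive x : 0 < x < 1 -> is_derive x 1 A (F x).
Proof.
move=> /andP[x0 x1].
have [] := @continuous_FTC1_closed R F 0 x 1 x1 _ x0 _.
- apply: cdfF_integrable; first exact: measurable_itv.
  by rewrite /= lebesgue_measure_itv/= lte_fin ltr01 -EFinB ltry.
- apply: (within_continuous_continuous ltr01 cdfF_cont).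
  by rewrite in_itv/= x0.
- by move=> dA AE; apply: DeriveDef; [exact: dA|rewrite -derive1E; exact: AE].
Qed.

Lemma measurable_AF : measurable_fun setT (A : measurableTypeR R -> R).
Proof.
apply: nondecreasing_measurable => // x y xy.
case: (leP 0 x) => x0; first exact: AF_homo.
(* For a negative argument the domain of integration is empty. *)
rewrite [A x](_ : _ = 0); last first.
  by rewrite /AF set_itv_ge ?Rintegral_set0// bnd_simp -ltNge.
case: (leP 0 y) => y0; first exact: AF_ge0.
by rewrite /AF set_itv_ge ?Rintegral_set0// bnd_simp -ltNge.
Qed.

End Distribution.

(** * The stage-1 bid rule *)

(** The clause [v == 0] keeps type 0 in the pool when [c = 0], where the separating formula would
    divide by [F 0 = 0]; the clause [c == 1] assigns type 1 to the pool under full pooling. For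
    [0 < c < 1] the cutoff type separates. *)
Definition pooled {R : realType} (c v : R) : bool := [|| v < c, v == 0 | c == 1].

Definition pool_bid {R : realType} (P : probability (measurableTypeR R) R)
    (k2 c v : R) : R :=
  if pooled c v then 0 else v - (AF P v - (1 - k2) * AF P c) / cdfF P v.

Section PoolBid.
Context {R : realType} (P : probability (measurableTypeR R) R) (k2 c : R).
Hypothesis hP : value_distribution P.
Hypothesis hk2 : 0 <= k2 <= 1.
Hypothesis hc : 0 <= c <= 1.
Implicit Types x y u v w b : R.
Local Notation F := (cdfF P).
Local Notation A := (AF P).
Local Notation s := (pool_bid P k2 c).
Local Notation d := (dF P k2 c).

Lemma pool_bid_pooled v : pooled c v -> s v = 0.
Proof. by rewrite /pool_bid => ->. Qed.

Lemma pooled_le v : 0 <= v <= 1 -> pooled c v -> v <= c.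
Proof.
move=> /andP[v0 v1] /or3P[/ltW//|/eqP->|/eqP->//].
by case/andP: hc.
Qed.

Lemma unpooledP v : 0 <= v <= 1 -> ~~ pooled c v -> [/\ c <= v, 0 < v & c < 1].
Proof.
move=> /andP[v0 v1]; rewrite /pooled !negb_or -leNgt => /and3P[cv vn0 cn1].
by split=> //; rewrite lt_def ?vn0// eq_sym cn1; case/andP: hc.
Qed.

Lemma unpooled_intro v : c <= v -> 0 < v -> c < 1 -> ~~ pooled c v.
Proof. by move=> cv v0 c1; rewrite /pooled !negb_or -leNgt cv gt_eqF// lt_eqF. Qed.

Lemma unpooled_up v w : 0 <= v <= 1 -> v <= w -> ~~ pooled c v -> ~~ pooled c w.
Proof.
move=> v01 vw /(unpooledP v v01)[cv v0 c1].
by apply: unpooled_intro => //; [exact: le_trans vw|exact: lt_le_trans vw].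
Qed.

(* The rent [A v - (1 - k2) A c] of a separating type, as in the envelope formula. *)
Lemma pool_bid_rent v : 0 <= v <= 1 -> ~~ pooled c v ->
  (v - s v) * F v = A v - (1 - k2) * A c.
Proof.
move=> v01 Zv; rewrite /pool_bid (negbTE Zv).
have [_ v0 _] := unpooledP v v01 Zv.
have Fv : F v != 0 by rewrite gt_eqF// (cdfF_gt0 P hP)// v0; case/andP: v01.
by rewrite opprB addrCA subrr addr0 divfK.
Qed.

(** Indifference of the cutoff type: beating exactly the pool at price [d] yields its pooling payoff
    [k2 * A c]. *)
Lemma dF_rent : (c - d) * F c = k2 * A c.
Proof.
rewrite /dF; case: eqP => [->|/eqP c0]; first by rewrite AF0 subrr mul0r mulr0.
have Fc : F c != 0.
  by rewrite gt_eqF// (cdfF_gt0 P hP)// lt_def c0; case/andP: hc => -> ->.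
by rewrite opprB addrCA subrr addr0 divfK.
Qed.

Lemma AFc_ge0 : 0 <= A c. Proof. by apply: AF_ge0; case/andP: hc. Qed.

Lemma rent_ge0 v : c <= v -> 0 <= A v - (1 - k2) * A c.
Proof.
move=> cv; have /andP[c0 c1] := hc; have /andP[k0 k1] := hk2.
have := AF_homo P c v c0 cv; have := AFc_ge0; nra.
Qed.

(** [s v * F v] equals [(v * F v - A v) + (1 - k2) * A c], whose first term is positive by strict
    convexity. *)
Lemma pool_bid_gt0 v : 0 <= v <= 1 -> ~~ pooled c v -> 0 < s v.
Proof.
move=> v01 Zv; have [cv v0 c1] := unpooledP v v01 Zv.
have vF : 0 < v <= 1 by rewrite v0; case/andP: v01.
have Fv := cdfF_gt0 P hP v vF.
have E := pool_bid_rent v v01 Zv; have := AF_lt P hP v vF.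
have /andP[k0 k1] := hk2; have := AFc_ge0.
rewrite -(pmulr_lgt0 (s v) Fv); nra.
Qed.

Lemma pool_bid_le v : 0 <= v <= 1 -> s v <= v.
Proof.
move=> v01; have [Zv|Zv] := boolP (pooled c v).
  by rewrite pool_bid_pooled//; case/andP: v01.
have [cv v0 c1] := unpooledP v v01 Zv.
have Fv : 0 < F v by apply: (cdfF_gt0 P hP); rewrite v0; case/andP: v01.
by rewrite -subr_ge0 -(pmulr_lge0 _ Fv) pool_bid_rent// rent_ge0.
Qed.

Lemma pool_bid_ge0 v : 0 <= v <= 1 -> 0 <= s v.
Proof.
move=> v01; have [Zv|Zv] := boolP (pooled c v); first by rewrite pool_bid_pooled.
exact/ltW/pool_bid_gt0.
Qed.

Lemma pool_bid_eq0 v : 0 <= v <= 1 -> (s v == 0) = pooled c v.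
Proof.
move=> v01; have [Zv|Zv] := boolP (pooled c v); first by rewrite pool_bid_pooled// eqxx.
by rewrite gt_eqF// pool_bid_gt0.
Qed.

(** By the rent identity [(s w - s v) * F w] is the sum of [(w - v) * F w - (A w - A v)], positive
    by strict convexity, and [(v - s v) * (F w - F v)], which is nonnegative. No derivative is
    involved, so the endpoints need no separate treatment. *)
Lemma pool_bid_lt v w : 0 <= v <= 1 -> ~~ pooled c v -> v < w -> w <= 1 -> s v < s w.
Proof.
move=> v01 Zv vw w1; have [cv v0 c1] := unpooledP v v01 Zv.
have w01 : 0 <= w <= 1 by rewrite w1 (ltW (lt_trans v0 vw)).
have Zw := unpooled_up v w v01 (ltW vw) Zv.
have Fv : 0 < F v by apply: (cdfF_gt0 P hP); rewrite v0; case/andP: v01.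
have Fvw := cdfF_lt P hP v w (ltW v0) vw w1.
have Ev := pool_bid_rent v v01 Zv; have Ew := pool_bid_rent w w01 Zw.
have sv := pool_bid_le v v01.
have SC := AF_strict_convex P hP v w (ltW v0) vw w1.
have Fw : 0 < F w by exact: lt_trans Fvw.
rewrite -subr_gt0 -(pmulr_lgt0 _ Fw).
have : 0 <= (v - s v) * (F w - F v) by apply: mulr_ge0; rewrite subr_ge0// ltW.
have -> : (s w - s v) * F w = w * F w - s v * F w - (w - s w) * F w by ring.
rewrite Ew; move: Ev SC; rewrite !(mulrBl, mulrBr); lra.
Qed.

Lemma pool_bid_homo v w : 0 <= v <= 1 -> 0 <= w <= 1 -> v <= w -> s v <= s w.
Proof.
move=> v01 w01; rewrite le_eqVlt => /predU1P[->//|vw].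
have [Zv|Zv] := boolP (pooled c v); first by rewrite pool_bid_pooled// pool_bid_ge0.
by apply/ltW/pool_bid_lt => //; case/andP: w01.
Qed.

Lemma pool_bid_cutoff : 0 < c < 1 -> s c = d.
Proof.
move=> /andP[c0 c1]; rewrite /pool_bid ifN; last exact: unpooled_intro.
by rewrite /dF gt_eqF//; congr (_ - _ / _); ring.
Qed.

Lemma dF_le_pool_bid v : 0 <= v <= 1 -> ~~ pooled c v -> d <= s v.
Proof.
move=> v01 Zv; have [cv v0 c1] := unpooledP v v01 Zv.
have [c0|c0] := eqVneq c 0.
  by rewrite (_ : d = 0) ?pool_bid_ge0// /dF c0 eqxx.
rewrite -pool_bid_cutoff; last by rewrite c1 lt_def c0; case/andP: hc => ->.
by apply: pool_bid_homo.
Qed.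

Lemma pool_bid_inj v w : 0 <= v <= 1 -> 0 <= w <= 1 -> ~~ pooled c v ->
  s v = s w -> v = w.
Proof.
move=> v01 w01 Zv E; have Zw : ~~ pooled c w.
  by rewrite -pool_bid_eq0// -E pool_bid_eq0.
case: (ltgtP v w) => // vw.
- by have := pool_bid_lt v w v01 Zv vw; rewrite E ltxx; case/andP: w01 => _ -> /(_ isT).
- by have := pool_bid_lt w v w01 Zw vw; rewrite E ltxx; case/andP: v01 => _ -> /(_ isT).
Qed.

(** Multiplied by [F u], the conclusion is the first admissibility condition at [u]. *)
Lemma pool_bid_ge_k2 u :
  (forall u, c <= u <= 1 -> A u <= (1 - k2) * (u * F u + A c)) ->
  0 <= u <= 1 -> ~~ pooled c u -> k2 * u <= s u.
Proof.
move=> adm u01 Zu; have [cu u0 c1] := unpooledP u u01 Zu.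
have u1 : u <= 1 by case/andP: u01.
have Fu : 0 < F u by apply: (cdfF_gt0 P hP); rewrite u0.
have E := pool_bid_rent u u01 Zu.
rewrite -subr_ge0 -(pmulr_lge0 _ Fu).
have := adm u; rewrite cu u1 => /(_ isT).
lra.
Qed.

Lemma measurable_invr : measurable_fun setT (GRing.inv : measurableTypeR R -> R).
Proof.
(* The total inverse has value 0 at 0 and is continuous on the open set away from 0. *)
have -> : (GRing.inv : R -> R) = fun x => if x == 0 then 0 else x^-1.
  by apply/funext => x; case: eqP => // ->; rewrite invr0.
apply: measurable_fun_if => //.
- by apply: measurable_fun_eqr => //.
- rewrite (_ : _ `&` _ = [set x : R | x != 0]); last first.
    by apply/seteqP; split => x /=; [case=> _ /eqP/eqP ->|move/negbTE => ->].
  apply: open_continuous_measurable_fun => //.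
  by move=> x; rewrite inE => x0; exact: inv_continuous.
Qed.

Lemma measurable_divr (f g : R -> R) :
  measurable_fun setT (f : measurableTypeR R -> R) ->
  measurable_fun setT (g : measurableTypeR R -> R) ->
  measurable_fun setT ((fun x => f x / g x) : measurableTypeR R -> R).
Proof.
move=> mf mg; apply: measurable_funM => //.
by apply: measurableT_comp => //; exact: measurable_invr.
Qed.

Lemma measurable_pooled : measurable_fun setT (pooled c : measurableTypeR R -> bool).
Proof.
rewrite /pooled; apply: measurable_or; first exact: measurable_fun_ltr.
by apply: measurable_or => //; exact: measurable_fun_eqr.
Qed.

Lemma measurable_pool_bid : measurable_fun setT (s : measurableTypeR R -> R).
Proof.
apply: measurable_fun_ifT => //; first exact: measurable_pooled.
apply: measurable_funB => //; apply: measurable_divr.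
  by apply: measurable_funB => //; exact: measurable_AF.
exact: measurable_cdfF.
Qed.

Lemma measurable_fpa_bid : measurable_fun setT (fpa_bid P : measurableTypeR R -> R).
Proof.
apply: measurable_fun_ifT => //; first exact: measurable_fun_eqr.
apply: measurable_funB => //; apply: measurable_divr; first exact: measurable_AF.
exact: measurable_cdfF.
Qed.

Lemma fpa_bid_rent v : 0 <= v <= 1 -> (v - fpa_bid P v) * F v = A v.
Proof.
move=> /andP[v0 v1]; rewrite /fpa_bid; case: eqP => [->|/eqP vn0].
  by rewrite AF0 subrr mul0r.
have Fv : F v != 0 by rewrite gt_eqF// (cdfF_gt0 P hP)// lt_def vn0 v0.
by rewrite opprB addrCA subrr addr0 divfK.
Qed.

Lemma fpa_bid_ge0 v : 0 <= v <= 1 -> 0 <= fpa_bid P v.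
Proof.
move=> v01; have [v0|v0] := eqVneq v 0; first by rewrite /fpa_bid v0 eqxx.
have Fv : 0 < F v by apply: (cdfF_gt0 P hP); rewrite lt_def v0.
have := AF_le P v v01; have := fpa_bid_rent v v01 => E.
rewrite -(pmulr_lge0 _ Fv); lra.
Qed.

Lemma fpa_bid_le v : 0 <= v <= 1 -> fpa_bid P v <= v.
Proof.
move=> v01; have [v0|v0] := eqVneq v 0; first by rewrite /fpa_bid v0 eqxx.
have Fv : 0 < F v by apply: (cdfF_gt0 P hP); rewrite lt_def v0.
rewrite -subr_ge0 -(pmulr_lge0 _ Fv) fpa_bid_rent//; apply: AF_ge0.
by case/andP: v01.
Qed.

Lemma fpa_bid_lt v w : 0 <= v -> v < w -> w <= 1 -> fpa_bid P v < fpa_bid P w.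
Proof.
move=> v0 vw w1.
have v01 : 0 <= v <= 1 by rewrite v0 (ltW (lt_le_trans vw w1)).
have w01 : 0 <= w <= 1 by rewrite w1 ltW ?(le_lt_trans v0).
have Fw : 0 < F w by apply: (cdfF_gt0 P hP); rewrite w1 (le_lt_trans v0).
have Fvw := cdfF_lt P hP v w v0 vw w1.
have Ev := fpa_bid_rent v v01; have Ew := fpa_bid_rent w w01.
have SC := AF_strict_convex P hP v w v0 vw w1.
rewrite -subr_gt0 -(pmulr_lgt0 _ Fw).
have : 0 <= (v - fpa_bid P v) * (F w - F v).
  by apply: mulr_ge0; rewrite subr_ge0 ?fpa_bid_le// ltW.
move: Ev Ew SC; rewrite !(mulrBl, mulrBr); lra.
Qed.

End PoolBid.

(** * Smoothness of the positive branch *)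

Section Regularity.
Context {R : realType} (P : probability (measurableTypeR R) R) (k2 c : R).
Hypothesis hP : value_distribution P.
Hypothesis hk2 : 0 <= k2 <= 1.
Hypothesis hc : 0 <= c <= 1.
Implicit Types x y v w : R.
Local Notation F := (cdfF P).
Local Notation A := (AF P).
Local Notation s := (pool_bid P k2 c).
Local Notation K := ((1 - k2) * AF P c).

Let hc0 : 0 <= c. Proof. by case/andP: hc. Qed.

Let F_gt0 x : c < x -> x <= 1 -> 0 < F x.
Proof. by move=> cx x1; apply: (cdfF_gt0 P hP); rewrite x1 (le_lt_trans hc0). Qed.

Lemma pool_bid_above x : c < x -> x <= 1 -> s x = x - (A x - K) / F x.
Proof.
move=> cx x1; rewrite /pool_bid ifN//.
by apply: unpooled_intro; [exact: ltW|exact: le_lt_trans cx|exact: lt_le_trans x1].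
Qed.

Lemma pool_bid_cont : {within `]c, 1]%classic, continuous s}.
Proof.
have sub : `]c, 1]%classic `<=` `[0, 1]%classic.
  by move=> x /=; rewrite !in_itv/= => /andP[cx ->]; rewrite (le_trans hc0 (ltW cx)).
have cF := continuous_subspaceW sub (cdfF_cont P hP).
have cA := continuous_subspaceW sub (AF_cont P).
apply: (@subspace_eq_continuous _ _ _ (fun x => x - (A x - K) / F x)).
  by move=> x; rewrite inE/= in_itv/= => /andP[cx x1]; exact: esym (pool_bid_above x cx x1).
apply/subspace_continuousP => x cx1.
have /subspace_continuousP/(_ x cx1) cFx := cF.
have /subspace_continuousP/(_ x cx1) cAx := cA.
apply: cvgB; first exact: cvg_within.
apply: cvgM; first by apply: cvgB => //; exact: cvg_cst.
apply: cvgV => //; rewrite gt_eqF//.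
by move: cx1 => /=; rewrite in_itv/= => /andP[cx x1]; exact: F_gt0.
Qed.

(** Since [A] has derivative [F], the quotient rule produces a term [F / F] that cancels the
    derivative of the leading [x]; only the term in the density survives. *)
Lemma pool_bid_is_derive x : c < x < 1 ->
  is_derive x 1 s ((A x - K) * derive1 F x / F x ^+ 2).
Proof.
move=> /andP[cx x1].
have Fx : F x != 0 by rewrite gt_eqF// F_gt0// ltW.
apply: (@near_eq_is_derive _ _ _ (fun x => x - (A x - K) / F x)).
  near=> y; rewrite pool_bid_above//; near: y; first exact: lt_nbhsr.
  by near do apply: ltW; exact: lt_nbhsl.
have x01 : 0 < x < 1 by rewrite x1 (le_lt_trans hc0 cx).
have dA := AF_is_derive P hP x x01.
have dF : is_derive x 1 F (derive1 F x).
  by case: hP => _ _ _ /(_ x x01)[dF _] _; rewrite derive1E; exact: derivableP.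
have dV := is_deriveV Fx dF.
have H := is_deriveB (is_derive_id x 1) (is_deriveM (is_deriveB dA (is_derive_cst K x 1)) dV).
apply: is_derive_eq.
by rewrite !fctE /GRing.scale/=; field.
Unshelve. all: by end_near. Qed.

Lemma pool_bid_derive1 x : c < x < 1 ->
  derive1 s x = (A x - K) * derive1 F x / F x ^+ 2.
Proof. by move=> /pool_bid_is_derive dx; rewrite derive1E; exact: derive_val. Qed.

Lemma pool_bid_C1 : C1_on_oo s c 1.
Proof.
move=> x cx1; have dx := pool_bid_is_derive x cx1; split; first exact: ex_derive.
have /andP[cx x1] := cx1.
have x01 : 0 < x < 1 by rewrite x1 (le_lt_trans hc0 cx).
have Fx : F x != 0 by rewrite gt_eqF// F_gt0// ltW.
change (derive1 s @ x --> derive1 s x); rewrite pool_bid_derive1//.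
apply: (@cvg_trans _ ((fun y => (A y - K) * derive1 F y / F y ^+ 2) @ x)).
  apply: near_eq_cvg; near=> y; rewrite pool_bid_derive1//; apply/andP; split.
    by near: y; exact: lt_nbhsr.
  by near: y; exact: lt_nbhsl.
have x01' : x \in `]0, 1[ by rewrite in_itv.
have cF := within_continuous_continuous ltr01 (cdfF_cont P hP) x01'.
have cA := within_continuous_continuous ltr01 (AF_cont P) x01'.
case: hP => _ _ _ /(_ x x01)[_ cf] _.
apply: (@cvgM R R (nbhs x) _ (fun y => (A y - K) * derive1 F y) (fun y => (F y ^+ 2)^-1)).
  by apply: cvgM => //; apply: cvgB => //; exact: cvg_cst.
by apply: cvgV; [rewrite expf_neq0|apply: cvgM].
Unshelve. all: by end_near. Qed.

(** With [F 1 = 1], the slope formula of the open interval predicts the limit [(A 1 - K) * l]; the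
    difference quotient is shown to have the same limit. *)
Lemma pool_bid_C1_at_left : c < 1 -> C1_at_left F 1 -> C1_at_left s 1.
Proof.
move=> c1 [l [ql dl]]; exists ((A 1 - K) * l).
have [_ _ cF] := (continuous_within_itvP F ltr01).1 (cdfF_cont P hP).
have [_ _ cA] := (continuous_within_itvP A ltr01).1 (AF_cont P).
have near_c : \forall x \near (1 : R)^'-, c < x by exact: nbhs_left_gt.
have near_1 : \forall x \near (1 : R)^'-, x < 1 by exact: nbhs_left_lt.
rewrite (cdfF1 P hP) in cF.
have cV : (F x)^-1 @[x --> (1:R)^'-] --> (1 : R).
  by rewrite -[X in _ --> X]invr1; apply: cvgV => //; exact: oner_neq0.
split.
(* The quotient of [s] is rearranged into those of [A] and [F]. The one of [F] tends to [l], the one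
   of [A] to 1, so the leading 1 cancels in the limit. *)
- apply: (@cvg_trans _ ((fun x => 1 - ((A x - A 1) / (x - 1) -
     (A 1 - K) * ((F x - F 1) / (x - 1))) * (F x)^-1) @ (1:R)^'-)).
    apply: near_eq_cvg; near=> x.
    have cx : c < x by near: x.
    have x1 : x < 1 by near: x.
    rewrite !pool_bid_above ?(ltW x1)// (cdfF1 P hP).
    by field; rewrite subr_eq0 lt_eqF//= gt_eqF// F_gt0// ltW.
  have -> : (A 1 - K) * l = 1 - (1 - (A 1 - K) * l) * 1 by ring.
  apply: cvgB; first exact: cvg_cst.
  apply: cvgM => //; apply: cvgB; last by apply: cvgM => //; exact: cvg_cst.
  (* [AF_bounds] squeezes the quotient of [A] between [F x] and [F 1 = 1]. *)
  apply: (@squeeze_cvgr _ _ _ _ F (cst 1)) => //; last exact: cvg_cst.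
  near=> x.
  have cx : c < x by near: x.
  have x1 : x < 1 by near: x.
  have := AF_bounds P x 1 (le_trans hc0 (ltW cx)) (ltW x1).
  rewrite (cdfF1 P hP) -(opprB (A 1)) -(opprB 1 x) invrN mulrNN.
  by rewrite ler_pdivlMr ?subr_gt0// ler_pdivrMr ?subr_gt0// mul1r mulr1 mulrC.
- apply: (@cvg_trans _ ((fun y => (A y - K) * derive1 F y / F y ^+ 2) @ (1:R)^'-)).
    apply: near_eq_cvg; near=> x; rewrite pool_bid_derive1//; apply/andP.
    by split; near: x.
  have -> : (A 1 - K) * l = (A 1 - K) * l / 1 ^+ 2 by rewrite expr1n divr1.
  apply: cvgM; first by apply: cvgM => //; apply: cvgB => //; exact: cvg_cst.
  by apply: cvgV; [rewrite expr1n oner_neq0|apply: cvgM].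
Unshelve. all: by end_near. Qed.

Lemma pool_bid_regular : regular_uni_pooling P s c.
Proof.
split.
- by split=> // v v0 vc; rewrite /pool_bid /pooled vc.
- move=> v /andP[cv v1]; apply: pool_bid_gt0 => //.
    by rewrite v1 (le_trans hc0 (ltW cv)).
  by apply: unpooled_intro; [exact: ltW|exact: le_lt_trans cv|exact: lt_le_trans v1].
- move=> v w cv vw w1; apply: pool_bid_lt => //.
    by rewrite (le_trans hc0 (ltW cv)) (ltW (lt_le_trans vw w1)).
  apply: unpooled_intro; [exact: ltW|exact: le_lt_trans cv|].
  exact: lt_trans cv (lt_le_trans vw w1).
- split; [exact: pool_bid_cont|exact: pool_bid_C1|exact: pool_bid_C1_at_left].
- by move=> v v01; rewrite pool_bid_ge0// pool_bid_le.
Qed.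

End Regularity.

(** * Existence of admissible cutoffs *)

Lemma Kplus_le {R : realType} (P : probability (measurableTypeR R) R) (k2 : R) :
  (Kplus P <= k2) = (1 <= k2 * (1 + AF P 1)).
Proof.
have A1 : 0 < 1 + AF P 1 by rewrite ltr_pwDl// AF_ge0.
by rewrite /Kplus -[X in X <= _]div1r ler_pdivrMr.
Qed.

Lemma dF1 {R : realType} (P : probability (measurableTypeR R) R)
  (hP : value_distribution P) (k2 : R) : dF P k2 1 = 1 - k2 * AF P 1.
Proof. by rewrite /dF oner_eq0 (cdfF1 P hP) divr1. Qed.

(* The intermediate value theorem gives a cutoff with [dF c = k2]; the bids
   above it then exceed [k2], hence [k2 * u]. *)
Lemma admissible_cutoff_ex {R : realType} (P : probability (measurableTypeR R) R)
    (hP : value_distribution P) (k2 : R) :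
  0 <= k2 <= 1 -> k2 < Kplus P -> exists c, admissible_cutoff P k2 c.
Proof.
move=> hk2; have /andP[k0 k1] := hk2.
rewrite ltNge Kplus_le -ltNge => kA.
have A1 := AF_ge0 P 1 ler01.
(* Without continuation value the cutoff 0 works, as [A u <= u * F u]. Otherwise the search on
   [[k2, 1]] keeps [F c] positive. *)
have [k20|k20] := eqVneq k2 0.
  exists 0; split; first by rewrite lexx ltr01.
    move=> u u01; rewrite k20 subr0 mul1r AF0 addr0.
    exact: (AF_le P u).
  by rewrite /dF eqxx.
have kpos : 0 < k2 by rewrite lt_def k20.
have klt1 : k2 < 1 by nra.
(* For positive [x] this is [(dF P k2 x - k2) * F x], cleared of the denominator. It equals
   [- k2 * A k2] at [k2], and [1 - k2 * (1 + A 1)] at 1, positive because [k2 < Kplus P]. *)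
pose G x := x * cdfF P x - k2 * AF P x - k2 * cdfF P x.
have cG : {within `[k2, 1]%classic, continuous G}.
  have sub : `[k2, 1]%classic `<=` `[0, 1]%classic.
    by move=> x /=; rewrite !in_itv/= => /andP[cx ->]; rewrite (le_trans k0 cx).
  have /subspace_continuousP cF := continuous_subspaceW sub (cdfF_cont P hP).
  have /subspace_continuousP cA := continuous_subspaceW sub (AF_cont P).
  apply/subspace_continuousP => x x01.
  apply: cvgB; last by apply: cvgM; [exact: cvg_cst|exact: cF].
  apply: cvgB; last by apply: cvgM; [exact: cvg_cst|exact: cA].
  by apply: cvgM; [exact: cvg_within|exact: cF].
have Gk : G k2 <= 0 by rewrite /G; have := AF_ge0 P k2 k0; nra.
have G1 : 0 < G 1 by rewrite /G (cdfF1 P hP); lra.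
have : Num.min (G k2) (G 1) <= 0 <= Num.max (G k2) (G 1).
  have Gle : G k2 <= G 1 by exact: le_trans (ltW G1).
  by rewrite min_l ?max_r// Gk ltW.
move=> /(IVT (ltW klt1) cG)[c]; rewrite in_itv/= => /andP[kc c1] Gc.
have cpos : 0 < c by exact: lt_le_trans kc.
have cn1 : c < 1.
  rewrite lt_neqAle c1 andbT; apply/eqP => c1E; move: G1.
  by rewrite -c1E Gc ltxx.
have hc : 0 <= c <= 1 by rewrite ltW.
have Fc : 0 < cdfF P c by apply: (cdfF_gt0 P hP); rewrite cpos.
have dc : dF P k2 c = k2.
  rewrite /dF gt_eqF//; apply: (mulIf (lt0r_neq0 Fc)).
  by rewrite mulrBl divfK ?gt_eqF//; move: Gc; rewrite /G; lra.
exists c; split; rewrite ?dc//; first by rewrite ltW.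
move=> u /andP[cu u1].
have u01 : 0 <= u <= 1 by rewrite u1 (le_trans (ltW cpos)).
have Zu : ~~ pooled c u by apply: unpooled_intro => //; exact: lt_le_trans cu.
have := dF_le_pool_bid P k2 c hP hk2 hc u u01 Zu; rewrite dc => ks.
have Fu : 0 < cdfF P u by apply: (cdfF_gt0 P hP); rewrite u1 (lt_le_trans cpos).
have := pool_bid_rent P k2 c hP hc u u01 Zu.
have : 0 <= (pool_bid P k2 c u - k2 * u) * cdfF P u.
  by apply: mulr_ge0; [rewrite subr_ge0; nra|exact: ltW].
lra.
Qed.

(** * Winning probabilities and bounds on expected payoffs *)

Section Win.
Context {R : realType}.
Implicit Types x y : R.

Lemma win_ge0 x y : 0 <= win x y.
Proof. by rewrite /win; case: ifP => // _; case: ifP => // _; rewrite invr_ge0. Qed.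

Lemma win_le1 x y : win x y <= 1.
Proof. by rewrite /win; case: ifP => // _; case: ifP => // _; lra. Qed.

Lemma win_lt x y : y < x -> win x y = 1.
Proof. by rewrite /win => ->. Qed.

Lemma win_gt x y : x < y -> win x y = 0.
Proof. by move=> xy; rewrite /win ltNge (ltW xy)/= lt_eqF. Qed.

Lemma win_homo x y y' : y <= y' -> win y x <= win y' x.
Proof.
rewrite /win; case: (ltgtP x y) => [xy yy'|yx _|<-].
- by rewrite (lt_le_trans xy yy').
- by case: ifP => // _; case: ifP => // _; rewrite invr_ge0.
- by case: (ltgtP x y') => // _ _; lra.
Qed.

Lemma measurable_win d (T : measurableType d) (f g : T -> R) :
  measurable_fun setT (f : T -> measurableTypeR R) ->
  measurable_fun setT (g : T -> measurableTypeR R) ->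
  measurable_fun setT ((fun w => win (f w) (g w)) : T -> measurableTypeR R).
Proof.
move=> mf mg; rewrite /win; apply: measurable_fun_ifT => //.
  exact: measurable_fun_ltr.
by apply: measurable_fun_ifT => //; exact: measurable_fun_eqr.
Qed.

End Win.

Section Expectation.
Context {R : realType} (Q : probability (measurableTypeR R) R).
Variable g : measurableTypeR R -> R.
Hypothesis mg : measurable_fun setT g.
Hypothesis g0 : forall w, 0 <= g w.
Hypothesis g1 : forall w, g w <= 1.
Implicit Types v w x B C : R.
Local Notation W := (\int[Q]_(w in unit_itv) g w)%R.

Let mu01 : measurable (unit_itv : set (measurableTypeR R)).
Proof. exact: measurable_unit_itv. Qed.

Let ig : Q.-integrable unit_itv (EFin \o g).
Proof.
apply: measurable_bounded_integrable => //.
- by rewrite (le_lt_trans (probability_le1 _ _))// ltry.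
- exact: measurable_funTS.
- exists 1; split=> [|M M1 x _ /=]; first exact: num_real.
  by rewrite ger0_norm// (le_trans (g1 _))// ltW.
Qed.

Lemma integral_scaleE C :
  (\int[Q]_(w in unit_itv) (C * g w)%:E)%E = (C * W)%:E.
Proof.
under eq_integral do rewrite EFinM.
rewrite (integralZl mu01 ig) EFinM /Rintegral fineK//.
exact: integrable_fin_num.
Qed.

Let W_E : (W%:E = \int[Q]_(w in unit_itv) (g w)%:E)%E.
Proof. by rewrite /Rintegral fineK//; exact: integrable_fin_num. Qed.

Lemma expectation_ge0 : 0 <= W.
Proof. exact: Rintegral_ge0. Qed.

Lemma expectation_le_cdfF w : (forall w', w < w' -> w' <= 1 -> g w' = 0) ->
  W <= cdfF Q w.
Proof.
move=> gw; rewrite -lee_fin W_E EFin_cdfF.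
have mI : measurable (`]-oo, w]%classic : set (measurableTypeR R)).
  exact: measurable_itv.
rewrite -(setIT (`]-oo, w]%classic : set (measurableTypeR R))) -integral_indic//.
apply: (@le_trans _ _ (\int[Q]_(x in unit_itv) (\1_(`]-oo, w]%classic) x)%:E)%E).
  apply: ge0_le_integral => //.
  - by move=> x _; rewrite /= lee_fin.
  - by apply/measurable_EFinP; exact: measurable_funTS.
  - by apply/measurable_EFinP; exact: measurable_indic.
  - move=> x; rewrite /unit_itv /= in_itv/= lee_fin indicE => /andP[_ x1].
    case: (leP x w) => xw; first by rewrite mem_set ?g1//= in_itv.
    by rewrite gw.
apply: ge0_subset_integral => //.
  by apply/measurable_EFinP; exact: measurable_indic.
Qed.

Lemma expectation_le1 : W <= 1.
Proof.
by rewrite (le_trans (expectation_le_cdfF 1 _)) ?cdfF_le1// => w /lt_geF ->.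
Qed.

(** A prescribed bid beats the types below [v] and only ties with [v] itself; this costs nothing
    because [v] is not an atom. *)
Lemma cdfF_le_expectation v : Q unit_itv = 1%E -> Q [set v] = 0%E ->
  (forall w, 0 <= w < v -> g w = 1) -> cdfF Q v <= W.
Proof.
move=> Q1 Qv gv; rewrite -lee_fin W_E EFin_cdfF.
have mI : measurable (`]-oo, v[%classic : set (measurableTypeR R)).
  exact: measurable_itv.
have -> : Q `]-oo, v]%classic = Q (`]-oo, v[%classic `&` unit_itv).
  by rewrite probability_carrier// -(@setUitv1 _ _ _ _ true)// [LHS]measureU0.
rewrite -integral_indic//; apply: ge0_le_integral => //.
- by apply/measurable_EFinP; exact: measurable_indic.
- by apply/measurable_EFinP; exact: measurable_funTS.
- move=> x; rewrite /unit_itv /= in_itv/= lee_fin indicE => /andP[x0 x1].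
  case: (ltP x v) => xv; first by rewrite gv ?x0//; case: (_ \in _).
  by rewrite memNset ?g0//= in_itv/= ltNge xv.
Qed.

(* If [W > B / C], some type [w] has [cdfF Q w] strictly between the two, and
   then [g] cannot vanish above [w]. *)
Lemma payoff_le C B : 0 <= B ->
  (forall t, 0 < t < 1 -> exists2 w, 0 <= w <= 1 & cdfF Q w = t) ->
  (forall w w', 0 <= w -> w < w' -> w' <= 1 -> B < C * cdfF Q w -> g w' = 0) ->
  C * W <= B.
Proof.
move=> B0 sur gB; rewrite leNgt; apply/negP => BW.
have W0 := expectation_ge0; have W1 := expectation_le1.
have C0 : 0 < C by nra.
have Bt : B / C < W by rewrite ltr_pdivrMr// mulrC.
have B0' : 0 <= B / C by rewrite divr_ge0// ltW.
have BE : B / C * C = B by rewrite divfK// gt_eqF.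
(* The midpoint of [B / C] and [W] lies strictly between 0 and 1, since [0 <= B / C < W <= 1]. *)
have [|w /andP[w0 w1] wE] := sur ((B / C + W) / 2); first by apply/andP; split; lra.
have : W <= cdfF Q w.
  apply: expectation_le_cdfF => w' ww' w'1; apply: (gB w) => //.
  by rewrite wE; nra.
by rewrite wE; lra.
Qed.

End Expectation.

(** * The law of a pooled rival *)

Definition pool_set {R : realType} (c : R) : set (measurableTypeR R) :=
  unit_itv `&` [set v | pooled c v].

Lemma measurable_pool_set {R : realType} (c : R) : measurable (pool_set c).
Proof.
apply: measurableI; first exact: measurable_unit_itv.
by have := @measurable_pooled R c measurableT [set true] I; rewrite setTI.
Qed.

(* The posterior on a rival who bids [0]: the prior conditioned on the pool, and
   the point mass at [0] when the pool is null, i.e. when [c = 0]. *)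
Definition pool_prior {R : realType} (P : probability (measurableTypeR R) R)
    (c : R) : probability (measurableTypeR R) R :=
  mnormalize (mrestr P (measurable_pool_set c)) \d_(0 : measurableTypeR R).

Section PoolPrior.
Context {R : realType} (P : probability (measurableTypeR R) R) (c : R).
Hypothesis hP : value_distribution P.
Hypothesis hc : 0 <= c <= 1.
Implicit Types v w t : R.
Local Notation F := (cdfF P).
Local Notation Q := (pool_prior P c).

Lemma prior_unit : P unit_itv = 1%E.
Proof. by case: hP => -[]. Qed.

Lemma prior_atomless v : P [set v] = 0%E.
Proof. by case: hP => -[]. Qed.

(** Up to the null point [c], the pool is the interval [[0, c]]. *)
Lemma prior_pool_itv w : 0 <= w ->
  P (`]-oo, w]%classic `&` pool_set c) = (F (Num.min w c))%:E.
Proof.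
move=> w0; set m := Num.min w c.
have mI : measurable (`]-oo, m]%classic : set (measurableTypeR R)).
  exact: measurable_itv.
have mw : measurable (`]-oo, w]%classic : set (measurableTypeR R)).
  exact: measurable_itv.
have mZ := measurable_pool_set c.
have mU := @measurable_unit_itv R.
rewrite EFin_cdfF; apply/eqP; rewrite eq_le; apply/andP; split.
  apply: le_measure; rewrite ?inE//; first exact: measurableI.
  move=> v /=; rewrite !in_itv/= => -[vw [v01 Zv]].
  rewrite /m le_min vw; apply: pooled_le => //.
rewrite -(probability_carrier P unit_itv _ mU mI prior_unit).
(* Type [c] is pooled only for [c = 0] and [c = 1]; adding this null point avoids the case
   distinction. *)
have -> : P (`]-oo, w]%classic `&` pool_set c) =
    P (`]-oo, w]%classic `&` pool_set c `|` [set c]).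
  rewrite measureU0//; first exact: measurableI.
  exact: prior_atomless.
apply: le_measure; rewrite ?inE; first exact: measurableI.
  by apply: measurableU => //; exact: measurableI.
move=> v /=; rewrite /m !in_itv/= le_min => -[/andP[vw vc] v01].
have [->|vnc] := eqVneq v c; first by right.
by left; split=> //; split=> //=; rewrite /pooled lt_neqAle vnc vc.
Qed.

Lemma prior_pool : P (pool_set c) = (F c)%:E.
Proof.
rewrite -[in RHS](min_r (_ : c <= 1)); last by case/andP: hc.
rewrite -prior_pool_itv//; congr (P _); apply/seteqP; split => v /=; last by case.
by move=> Zv; split=> //; rewrite in_itv/=; case: Zv; rewrite /unit_itv/= in_itv/= => /andP[].
Qed.

Lemma pool_priorE (A : set (measurableTypeR R)) : 0 < c ->
  Q A = (P (A `&` pool_set c) * (F c)^-1%:E)%E.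
Proof.
move=> c0; have Fc : 0 < F c by apply: (cdfF_gt0 P hP); rewrite c0; case/andP: hc.
rewrite /pool_prior /= /mnormalize/= /mrestr setTI [X in X == 0%E]prior_pool.
by rewrite [X in X == +oo%E]prior_pool eqe gt_eqF//= prior_pool.
Qed.

Lemma pool_prior0 (A : set (measurableTypeR R)) : c = 0 ->
  Q A = \d_(0 : measurableTypeR R) A.
Proof.
move=> c0; rewrite /pool_prior /= /mnormalize/= /mrestr setTI.
by rewrite [X in X == 0%E]prior_pool c0 (cdfF0 P hP) eqxx.
Qed.

Lemma pool_prior_carrier : Q (pool_set c) = 1%E.
Proof.
have [c0|cn0] := eqVneq c 0.
  rewrite pool_prior0// diracE mem_set//; split => /=.
    by rewrite /unit_itv/= in_itv/= lexx ler01.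
  by rewrite /pooled eqxx orbT.
have c0 : 0 < c by rewrite lt_def cn0; case/andP: hc.
have Fc : 0 < F c by apply: (cdfF_gt0 P hP); rewrite c0; case/andP: hc.
by rewrite pool_priorE// setIid prior_pool -EFinM divff// gt_eqF.
Qed.

Lemma pool_prior_unit : Q unit_itv = 1%E.
Proof.
apply/eqP; rewrite eq_le probability_le1/=; last exact: measurable_unit_itv.
rewrite -pool_prior_carrier; apply: le_measure; rewrite ?inE.
- exact: measurable_pool_set.
- exact: measurable_unit_itv.
- by move=> v [].
Qed.

Lemma pool_prior_atomless v : 0 < c -> Q [set v] = 0%E.
Proof.
move=> c0; rewrite pool_priorE//; have -> : P ([set v] `&` pool_set c) = 0%E.
  apply/eqP; rewrite eq_le measure_ge0 andbT -(prior_atomless v).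
  apply: le_measure; rewrite ?inE//.
  by apply: measurableI => //; exact: measurable_pool_set.
by rewrite mul0e.
Qed.

Lemma cdfF_pool_prior w : 0 < c -> 0 <= w -> cdfF Q w = F (Num.min w c) / F c.
Proof.
by move=> c0 w0; rewrite /cdfF pool_priorE// prior_pool_itv.
Qed.

(** Up to [c] the conditional cdf is [F w / F c], so the witness solves [F w = t * F c] and falls
    below [c]. *)
Lemma cdfF_pool_prior_surj t : 0 < c -> 0 < t < 1 ->
  exists2 w, 0 <= w <= 1 & cdfF Q w = t.
Proof.
move=> c0 /andP[t0 t1].
have Fc : 0 < F c by apply: (cdfF_gt0 P hP); rewrite c0; case/andP: hc.
have [|w w01 wE] := cdfF_surj P hP (t * F c).
  have := cdfF_le1 P c => Fc1; rewrite mulr_ge0 ?(ltW t0) ?(ltW Fc)//=; nra.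
exists w => //; rewrite cdfF_pool_prior//; last by case/andP: w01.
rewrite min_l; first by rewrite wE mulfK// gt_eqF.
apply/ltW/(cdfF_le_inj P) => //.
by rewrite wE -[X in _ < X]mul1r ltr_pM2r.
Qed.

Lemma pool_prior1 (A : set (measurableTypeR R)) : c = 1 -> measurable A -> Q A = P A.
Proof.
move=> c1 mA; rewrite pool_priorE c1 ?ltr01// (cdfF1 P hP) invr1 mule1.
rewrite (_ : pool_set 1 = unit_itv); last first.
  by apply/seteqP; split => v; [case|move=> v01; split => //=; rewrite /pooled eqxx !orbT].
by apply: probability_carrier => //; [exact: measurable_unit_itv|exact: prior_unit].
Qed.

End PoolPrior.

(** * Strategies and beliefs *)

(** The auction bid under the whole prior is used even though the rival is known to be pooled: below
    [c], conditioning divides [A] and [F] by the same [F c] and leaves their ratio unchanged. *)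
Definition pool_bid2 {R : realType} (P : probability (measurableTypeR R) R)
    (c v b b' : R) : R :=
  if [&& b == 0, b' == 0 & pooled c v] then fpa_bid P v else Num.max b v.

(** For [c = 0] the threshold [d] is 0, and only the clause on positivity makes the proposer
    continue after two zero bids. *)
Definition pool_stop {R : realType} (d b b' : R) : bool :=
  (0 < Num.max b b') && (d <= Num.max b b').

(* The separating type bidding [b], or [0] (through [xget]) if there is none. *)
Definition pool_type {R : realType} (P : probability (measurableTypeR R) R)
    (k2 c b : R) : R :=
  xget 0 [set u | [/\ 0 <= u <= 1, ~~ pooled c u & pool_bid P k2 c u = b]].

Definition pool_posterior {R : realType} (P : probability (measurableTypeR R) R)
    (k2 c b : R) : probability (measurableTypeR R) R :=
  if b == 0 then pool_prior P c
  else \d_(pool_type P k2 c b : measurableTypeR R).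

(** Off path the belief is the one that supports the prescribed decision: with both values 0,
    continuing brings just [k2] times the highest bid so far; with both values 1, it brings at least
    [k2]. *)
Definition pool_belief {R : realType} (P : probability (measurableTypeR R) R)
    (k2 c b b' : R) : probability (measurableTypeR R * measurableTypeR R)%type R :=
  let on_path x := exists2 v : R, 0 <= v <= 1 & x = pool_bid P k2 c v in
  let prod : probability (measurableTypeR R * measurableTypeR R)%type R :=
    (pool_posterior P k2 c b \x pool_posterior P k2 c b')%E in
  if `[< on_path b /\ on_path b' >] then prod
  else \d_((if pool_stop (dF P k2 c) b b' then (0, 0) else (1, 1))
             : measurableTypeR R * measurableTypeR R).

(* Off path, everybody believes the rival to have value [1] and bids truthfully
   at stage 2, up to the constraint imposed by the stage-1 bid: then nobody can
   gain against the expected bid.  The proposer continues off path only on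
   bids below [dF P k2 c <= k2], believing both values to be [1]. *)
Definition pool_assessment {R : realType} (P : probability (measurableTypeR R) R)
    (k2 c : R) : assessment R :=
  Assessment (fun _ => pool_bid P k2 c) (pool_stop (dF P k2 c))
    (fun _ => pool_bid2 P c) (pool_belief P k2 c)
    (fun _ v b b' => if [&& b == 0, b' == 0 & pooled c v] then pool_prior P c
                     else \d_(1 : measurableTypeR R)).

Section Assessment.
Context {R : realType} (P : probability (measurableTypeR R) R) (k2 c : R).
Hypothesis hP : value_distribution P.
Hypothesis hk2 : 0 <= k2 <= 1.
Hypothesis hc : 0 <= c <= 1.
Hypothesis hd : dF P k2 c <= k2.
Hypothesis hadm : c < 1 -> forall u, c <= u <= 1 ->
  AF P u <= (1 - k2) * (u * cdfF P u + AF P c).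
Implicit Types v w x b : R.
Local Notation F := (cdfF P).
Local Notation A := (AF P).
Local Notation s := (pool_bid P k2 c).
Local Notation K := ((1 - k2) * AF P c).
Local Notation d := (dF P k2 c).
Local Notation a := (pool_assessment P k2 c).
Local Notation beta := (fpa_bid P).
Local Notation bid := (pool_bid2 P c).

Let k0 : 0 <= k2. Proof. by case/andP: hk2. Qed.
Let k1 : k2 <= 1. Proof. by case/andP: hk2. Qed.
Let c0 : 0 <= c. Proof. by case/andP: hc. Qed.
Let c1 : c <= 1. Proof. by case/andP: hc. Qed.

Lemma measurable_pool_bid2 d' (T : measurableType d') (f g h : T -> R) :
  measurable_fun setT (f : T -> measurableTypeR R) ->
  measurable_fun setT (g : T -> measurableTypeR R) ->
  measurable_fun setT (h : T -> measurableTypeR R) ->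
  measurable_fun setT ((fun t => bid (f t) (g t) (h t)) : T -> measurableTypeR R).
Proof.
move=> mf mg mh; rewrite /pool_bid2; apply: measurable_fun_ifT.
- apply: measurable_and; first exact: measurable_fun_eqr.
  apply: measurable_and; first exact: measurable_fun_eqr.
  by apply: (measurableT_comp (@measurable_pooled R c)).
- by apply: (measurableT_comp (measurable_fpa_bid P)).
- exact: measurable_maxr.
Qed.

Lemma pool_bid2_ge v b b' : 0 <= v <= 1 -> 0 <= b -> b <= bid v b b'.
Proof.
move=> v01 b0; rewrite /pool_bid2; case: ifP => [/and3P[/eqP-> _ _]|_].
  exact: fpa_bid_ge0.
by rewrite le_max lexx.
Qed.

Lemma pool_feasible : feasible a.
Proof.
split => /=.
- by move=> _; apply: measurable_funTS; exact: measurable_pool_bid.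
- by move=> _ v v01; exact: pool_bid_ge0.
- rewrite /pool_stop; apply: measurable_and.
    by apply: measurable_fun_ltr => //; exact: measurable_maxr.
  by apply: measurable_fun_ler => //; exact: measurable_maxr.
- move=> _; apply: measurable_pool_bid2 => //.
  + exact: (measurableT_comp measurable_fst).
  + exact: (measurableT_comp measurable_snd).
- by move=> _ v b b' v01 b0 _; exact: pool_bid2_ge.
Qed.

Lemma pool_symmetric : symmetric_profile a.
Proof. by split => //= b b' _ _; rewrite /pool_stop maxC. Qed.

Lemma pool_stopC i b b' : stops a i b b' = pool_stop d b b'.
Proof. by case: i; rewrite /stops//= /pool_stop maxC. Qed.

Lemma pool_stop_unpooled b w : 0 <= w <= 1 -> ~~ pooled c w -> pool_stop d b (s w).
Proof.
move=> w01 Zw; rewrite /pool_stop !lt_max !le_max (pool_bid_gt0 P k2 c)//.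
by rewrite (dF_le_pool_bid P k2 c)// !orbT.
Qed.

(** * Stage-1 rationality *)

Definition equilibrium_payoff v : R := if pooled c v then k2 * A v else A v - K.
Local Notation U := equilibrium_payoff.

Lemma equilibrium_payoff_ge0 v : 0 <= v <= 1 -> 0 <= U v.
Proof.
move=> v01; rewrite /U; case: ifPn => [_|/(unpooledP c hc v v01)[cv _ _]].
  by rewrite mulr_ge0// AF_ge0//; case/andP: v01.
exact: rent_ge0.
Qed.

(** The two formulas agree at [c], and below [c] the pooling payoff decreases more slowly as [v]
    falls, by the factor [k2]. So the separating formula bounds [U] from below for every type. *)
Lemma rent_le v : 0 <= v <= 1 -> A v - K <= U v.
Proof.
move=> v01; rewrite /U; case: ifPn => // /(pooled_le c hc v v01) vc.
have /andP[v0 _] := v01.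
have := AF_homo P v c v0 vc; have := k1; nra.
Qed.

Lemma pooling_deviation v w : 0 <= v <= 1 -> 0 <= w <= 1 -> pooled c w ->
  k2 * ((v - w) * F w + A w) <= U v.
Proof.
move=> v01 w01 /(pooled_le c hc w w01) wc.
have /andP[v0 v1] := v01; have /andP[w0 w1] := w01.
rewrite /U; case: ifPn => [_|/(unpooledP c hc v v01)[cv _ _]].
  by apply: ler_wpM2l => //; rewrite addrC; exact: AF_convex.
(* A separating type would rather imitate [c] than a lower pooled type, and
   [k2 * ((v - c) * F c + A c)] is at most [(v - c) * F c + k2 * A c], which convexity bounds by
   [A v - K]. *)
have H1 := AF_convex P w c w0 c0; have H2 := AF_convex P c v c0 v0.
have H3 : (v - c) * F w <= (v - c) * F c.
  by apply: ler_wpM2l; [rewrite subr_ge0|exact: cdfF_homo].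
have H4 : 0 <= (v - c) * F c by rewrite mulr_ge0 ?subr_ge0 ?cdfF_ge0.
have : k2 * ((v - w) * F w + A w) <= k2 * ((v - c) * F c + A c).
  by apply: ler_wpM2l => //; move: H1 H3; rewrite !mulrBl; lra.
have : k2 * ((v - c) * F c) <= (v - c) * F c by rewrite ler_piMl.
lra.
Qed.

(* Type [w]'s rent bounds what [v] gets by bidding at least as much as [w]. *)
Lemma fpa_deviation v w x t : 0 <= w <= 1 -> beta w <= x -> x <= v ->
  0 <= t <= F w -> (v - x) * t <= (v - w) * F w + A w.
Proof.
move=> w01 bx xv /andP[t0 tw]; rewrite -(fpa_bid_rent P hP w w01) -mulrDl.
by apply: ler_pM; rewrite ?subr_ge0// subrKA lerB.
Qed.

Let expect (Q : probability (measurableTypeR R) R) g :=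
  (\int[Q]_(w in unit_itv) g w)%R.

Definition ctn_win x b w : R := if pooled c w then win x (bid w 0 b) else 0.

Lemma measurable_ctn_win x b :
  measurable_fun setT (ctn_win x b : measurableTypeR R -> R).
Proof.
apply: measurable_fun_ifT => //; first exact: measurable_pooled.
by apply: measurable_win => //; exact: measurable_pool_bid2.
Qed.

Lemma ctn_win_ge0 x b w : 0 <= ctn_win x b w.
Proof. by rewrite /ctn_win; case: ifP => _ //; exact: win_ge0. Qed.

Lemma ctn_win_le1 x b w : ctn_win x b w <= 1.
Proof. by rewrite /ctn_win; case: ifP => _; rewrite ?win_le1. Qed.

(** Separating rivals bid at least [d] and more than 0, so they end the game and win. Stage 2 is
    reached only against pooled rivals, whose bid is 0; of the plan [p] only [p 0] matters. *)
Lemma stage1_payoff_ctn i v b p : 0 <= b -> (b < d) || (b == 0) ->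
  stage1_payoff P k2 a i v b p =
  (k2 * (v - p 0) * expect P (ctn_win (p 0) b))%:E.
Proof.
move=> b0 bd; rewrite /stage1_payoff -integral_scaleE.
- apply: eq_integral => w; rewrite inE /unit_itv/= in_itv/= => w01.
  rewrite pool_stopC /ctn_win; have [Zw|Zw] := boolP (pooled c w).
    rewrite pool_bid_pooled// /pool_stop (max_l b0).
    case: ifPn => [/andP[b0' db]|_]; last by rewrite mulrA.
    by move: bd; rewrite ltNge db/= gt_eqF.
  rewrite pool_stop_unpooled// win_gt ?mulr0//.
  case/orP: bd => [bd|/eqP->]; last exact: pool_bid_gt0.
  by apply: (lt_le_trans bd); exact: dF_le_pool_bid.
- exact: measurable_ctn_win.
- exact: ctn_win_ge0.
- exact: ctn_win_le1.
Qed.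

Lemma measurable_stop_win b :
  measurable_fun setT ((fun w => win b (s w)) : measurableTypeR R -> R).
Proof. by apply: measurable_win => //; exact: measurable_pool_bid. Qed.

Lemma stage1_payoff_stop i v b p : 0 < b -> d <= b ->
  stage1_payoff P k2 a i v b p =
  ((v - b) * expect P (fun w => win b (s w)))%:E.
Proof.
move=> b0 db; rewrite /stage1_payoff -integral_scaleE.
- apply: eq_integral => w _.
  by rewrite pool_stopC /pool_stop lt_max le_max b0 db.
- exact: measurable_stop_win.
- by move=> w; exact: win_ge0.
- by move=> w; exact: win_le1.
Qed.

Lemma stage1_deviation_le i v b p : 0 <= v <= 1 -> 0 <= b ->
  (stage1_payoff P k2 a i v b p <= (U v)%:E)%E.
Proof.
move=> v01 b0; have U0 := equilibrium_payoff_ge0 v v01.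
have v0 : 0 <= v by case/andP: v01.
have surP t : 0 < t < 1 -> exists2 w, 0 <= w <= 1 & F w = t.
  by move=> /andP[t0 t1]; apply: cdfF_surj => //; rewrite !ltW.
have [bd|bd] := boolP ((b < d) || (b == 0)).
  rewrite stage1_payoff_ctn// lee_fin; apply: payoff_le => //.
  - exact: measurable_ctn_win.
  - exact: ctn_win_ge0.
  - exact: ctn_win_le1.
  move=> w w' w0 ww' w'1 Uw; rewrite /ctn_win; case: ifPn => // Zw'.
  apply: win_gt; rewrite ltNge; apply/negP => bp.
  have w'01 : 0 <= w' <= 1 by rewrite w'1 (le_trans w0 (ltW ww')).
  have Fw := cdfF_ge0 P w.
  have kF := mulr_ge0 k0 Fw.
  have vp : 0 < v - p 0 by rewrite ltNge; apply/negP => vp; nra.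
  (* A pooled rival bids [beta w'] after [b = 0] and its value after a positive [b]; either way at
     least [beta w']. *)
  have bw' : beta w' <= p 0.
    apply: le_trans bp; rewrite /pool_bid2; case: ifP => // _.
    by rewrite le_max fpa_bid_le ?orbT.
  have /(ler_wpM2l k0) : (v - p 0) * F w <= (v - w') * F w' + A w'.
    apply: fpa_deviation => //; first by rewrite -subr_ge0 ltW.
    by rewrite Fw; apply: cdfF_homo; exact: ltW.
  have := pooling_deviation v w' v01 w'01 Zw'; lra.
move: bd; rewrite negb_or -leNgt => /andP[db bn0].
have bpos : 0 < b by rewrite lt_def bn0.
rewrite stage1_payoff_stop// lee_fin; apply: payoff_le => //.
- exact: measurable_stop_win.
- by move=> w; exact: win_ge0.
- by move=> w; exact: win_le1.
move=> w w' w0 ww' w'1 Uw; apply: win_gt; rewrite ltNge; apply/negP => sb.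
have w'01 : 0 <= w' <= 1 by rewrite w'1 (le_trans w0 (ltW ww')).
have Fw := cdfF_ge0 P w.
have vb : 0 < v - b by rewrite ltNge; apply/negP => vb; nra.
have rent := rent_le v v01.
have Fww' : F w <= F w' by apply: cdfF_homo; exact: ltW.
have w'0 : 0 <= w' by case/andP: w'01.
have [Zw'|Zw'] := boolP (pooled c w').
  have w'c := pooled_le c hc w' w'01 Zw'.
  have Fwc : F w <= F c by apply: le_trans Fww' _; exact: cdfF_homo.
  (* If only pooled types are known to be beaten, the gain is at most that of beating the whole pool
     at price [d]. By indifference of [c] this is [(v - c) * F c + k2 * A c], at most [A v - K]. *)
  have H : (v - b) * F w <= (v - d) * F c by apply: ler_pM => //; lra.
  have := AF_convex P c v c0 v0; have := dF_rent P k2 c hP hc => E.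
  move: E H; rewrite !mulrBl; lra.
(* Here the deviation earns no more than imitating [w'], that is [(v - w') * F w' + A w' - K]. *)
have H : (v - b) * F w <= (v - s w') * F w' by apply: ler_pM => //; lra.
have := AF_convex P w' v w'0 v0; have := pool_bid_rent P k2 c hP hc w' w'01 Zw' => E.
move: E H; rewrite !mulrBl; lra.
Qed.

(** The prescribed bids beat all lower types, hence win with probability at least [F v]; the rent
    identities turn the margin times [F v] into [U v]. *)
Lemma stage1_equilibrium_ge i v : 0 <= v <= 1 ->
  ((U v)%:E <= stage1_payoff P k2 a i v (s v) (bid v (s v)))%E.
Proof.
move=> v01; have /andP[v0 v1] := v01.
have P1 := prior_unit P hP; have Pv := prior_atomless P hP v.
rewrite /U; case: ifPn => Zv.
  rewrite pool_bid_pooled// stage1_payoff_ctn ?eqxx ?orbT// lee_fin.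
  rewrite -(fpa_bid_rent P hP v v01) mulrA /pool_bid2 !eqxx Zv/=.
  apply: ler_wpM2l; first by rewrite mulr_ge0// subr_ge0 fpa_bid_le.
  apply: cdfF_le_expectation => //.
  - exact: measurable_ctn_win.
  - exact: ctn_win_ge0.
  - exact: ctn_win_le1.
  move=> w /andP[w0 wv]; rewrite /ctn_win.
  have Zw : pooled c w.
    have := pooled_le c hc v v01 Zv => vc.
    by rewrite /pooled (lt_le_trans wv vc).
  by rewrite Zw /pool_bid2 !eqxx Zw/= win_lt//; exact: fpa_bid_lt.
rewrite stage1_payoff_stop; [|exact: pool_bid_gt0|exact: dF_le_pool_bid].
rewrite lee_fin -(pool_bid_rent P k2 c hP hc v v01 Zv).
apply: ler_wpM2l; first by rewrite subr_ge0 pool_bid_le.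
apply: cdfF_le_expectation => //.
- exact: measurable_stop_win.
- by move=> w; exact: win_ge0.
- by move=> w; exact: win_le1.
move=> w /andP[w0 wv]; apply: win_lt.
have w01 : 0 <= w <= 1 by rewrite w0 (le_trans (ltW wv) v1).
have [Zw|Zw] := boolP (pooled c w); last exact: pool_bid_lt.
by rewrite (pool_bid_pooled P k2 c w Zw) pool_bid_gt0.
Qed.

Lemma pool_stage1_rational : stage1_rational P k2 a.
Proof.
move=> i v b p v01 b0 _ _; apply: (le_trans (stage1_deviation_le i v b p v01 b0)).
exact: stage1_equilibrium_ge.
Qed.

(** * Stage-2 rationality *)

Definition pool_win x w : R := win x (bid w 0 0).

Lemma stage2_payoff_pooled i v x : pooled c v ->
  stage2_payoff k2 a i v 0 0 x =
  (k2 * (v - x) * expect (pool_prior P c) (pool_win x))%:E.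
Proof.
move=> Zv; rewrite /stage2_payoff /= eqxx Zv /= -integral_scaleE.
- by apply: eq_integral => w _; rewrite mulrA.
- by apply: measurable_win => //; exact: measurable_pool_bid2.
- by move=> w; exact: win_ge0.
- by move=> w; exact: win_le1.
Qed.

(** Both sides are compared with [k2 * (A v / F c)], the auction payoff of type [v] under the prior
    conditioned on the pool. *)
Lemma stage2_pooled_le i v x : 0 <= v <= 1 -> pooled c v -> 0 <= x ->
  (stage2_payoff k2 a i v 0 0 x <= stage2_payoff k2 a i v 0 0 (beta v))%E.
Proof.
move=> v01 Zv x0; have /andP[v0 v1] := v01.
rewrite !stage2_payoff_pooled// lee_fin.
have mW y : measurable_fun setT (pool_win y : measurableTypeR R -> R).
  by apply: measurable_win => //; exact: measurable_pool_bid2.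
have W0 y w : 0 <= pool_win y w by exact: win_ge0.
have W1 y w : pool_win y w <= 1 by exact: win_le1.
(* Type 0 gets 0 and cannot gain against any belief. This disposes of [c = 0], where the belief is a
   point mass; a positive pooled type forces [c > 0]. *)
have [vE|vn0] := eqVneq v 0.
  rewrite vE /fpa_bid eqxx subrr mulr0 mul0r sub0r mulrN mulNr oppr_le0.
  by rewrite mulr_ge0 ?mulr_ge0 ?expectation_ge0.
have vc := pooled_le c hc v v01 Zv.
have vpos : 0 < v by rewrite lt_def vn0.
have cpos : 0 < c by exact: lt_le_trans vc.
have Fc : 0 < F c by apply: (cdfF_gt0 P hP); rewrite cpos.
have Av : 0 <= A v by exact: AF_ge0.
apply: (@le_trans _ _ (k2 * (A v / F c))).
  apply: payoff_le => //.
  - by rewrite mulr_ge0// divr_ge0// ltW.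
  - by move=> t; exact: cdfF_pool_prior_surj.
  move=> w w' w0 ww' w'1; rewrite (cdfF_pool_prior P c)// => Uw.
  apply: win_gt; rewrite ltNge; apply/negP => bx.
  have w'01 : 0 <= w' <= 1 by rewrite w'1 (le_trans w0 (ltW ww')).
  have /andP[w'0 _] := w'01.
  have G0 : 0 <= F (Num.min w c) / F c by rewrite divr_ge0 ?cdfF_ge0// ltW.
  have B0 : 0 <= k2 * (A v / F c) by rewrite mulr_ge0// divr_ge0// ltW.
  have kG := mulr_ge0 k0 G0.
  have vx : 0 < v - x by rewrite ltNge; apply/negP => vx; nra.
  (* The integral also runs over separating types, but these bid their value here, which is at least
     [c >= v > x], and are not beaten. *)
  have [Zw'|Zw'] := boolP (pooled c w'); last first.
    have [cw' _ _] := unpooledP c hc w' w'01 Zw'.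
    by move: bx; rewrite /pool_bid2 !eqxx (negbTE Zw')/= (max_r w'0); lra.
  have w'c := pooled_le c hc w' w'01 Zw'.
  rewrite (min_l (le_trans (ltW ww') w'c)) in Uw.
  move: bx; rewrite /pool_bid2 !eqxx Zw'/= => bx.
  have : (v - x) * F w <= A v.
    apply: (@le_trans _ _ ((v - w') * F w' + A w')).
      apply: fpa_deviation => //; first by rewrite -subr_ge0 ltW.
      by rewrite cdfF_ge0; apply: cdfF_homo; exact: ltW.
    by rewrite addrC; exact: AF_convex.
  move=> H; have : (v - x) * F w / F c <= A v / F c by rewrite ler_pM2r ?invr_gt0.
  by move/(ler_wpM2l k0); lra.
rewrite -(fpa_bid_rent P hP v v01) -!mulrA.
apply: ler_wpM2l => //; apply: ler_wpM2l; first by rewrite subr_ge0 fpa_bid_le.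
rewrite -[X in X <= _](_ : cdfF (pool_prior P c) v = _); last first.
  by rewrite cdfF_pool_prior// min_l.
apply: cdfF_le_expectation => //.
- exact: pool_prior_unit.
- exact: pool_prior_atomless.
move=> w /andP[w0 wv]; have Zw : pooled c w by rewrite /pooled (lt_le_trans wv vc).
rewrite /pool_win /pool_bid2 !eqxx Zw/= win_lt//; exact: fpa_bid_lt.
Qed.

(** Type 1 is pooled only if all types are, so the rival believed to have value 1 uses the auction
    bid at none of the histories considered here. *)
Lemma pool_bid2_top v b b' : 0 <= v <= 1 ->
  ~~ [&& b == 0, b' == 0 & pooled c v] -> bid 1 b' b = Num.max b' 1.
Proof.
move=> v01 nZ; rewrite /pool_bid2 ifN//; apply: contra nZ => /and3P[-> -> Z1] /=.
by apply: contraLR Z1; apply: unpooled_up => //; case/andP: v01.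
Qed.

Lemma pool_stage2_rational : stage2_rational k2 a.
Proof.
move=> i v b b' x v01 b0 b'0 bx.
have [/and3P[/eqP bE /eqP b'E Zv]|nZ] := boolP [&& b == 0, b' == 0 & pooled c v].
  rewrite bE b'E in bx *; rewrite /= /pool_bid2 !eqxx Zv/=.
  exact: stage2_pooled_le.
have payoffE y : stage2_payoff k2 a i v b b' y =
    (k2 * ((v - y) * win y (Num.max b' 1)))%:E.
  rewrite /stage2_payoff /= (negbTE nZ) integral_dirac//.
  - rewrite diracE mem_set ?mul1e ?(pool_bid2_top v)//.
    by rewrite /unit_itv/= in_itv/= ler01 lexx.
  - exact: measurable_unit_itv.
  - apply/measurable_EFinP; apply: measurable_funTS.
    apply: measurable_funM => //; apply: measurable_funM => //.
    by apply: measurable_win => //; exact: measurable_pool_bid2.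
rewrite !payoffE lee_fin; apply: ler_wpM2l => //=.
rewrite /pool_bid2 (negbTE nZ); have /andP[v0 v1] := v01.
set y := Num.max b' 1; have y1 : 1 <= y by rewrite le_max lexx orbT.
have [bv|vb] := leP b v.
  rewrite subrr mul0r; have [xy|yx] := ltP x y; first by rewrite win_gt ?mulr0.
  by rewrite mulr_le0_ge0 ?win_ge0//; lra.
(* Committed to a bid above its value, the builder loses least at the lowest allowed bid: raising it
   increases both the loss and the chance of winning. *)
have := win_homo y b x bx; have := win_ge0 b y; have := win_ge0 x y; nra.
Qed.

(** * Posteriors and the proposer's choice *)

Lemma pool_type_separating u : 0 <= u <= 1 -> ~~ pooled c u ->
  pool_type P k2 c (s u) = u.
Proof.
move=> u01 Zu; rewrite /pool_type; case: xgetP => [w _ [w01 Zw sw]|/(_ u)].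
  exact: (pool_bid_inj P k2 c hP hk2 hc).
by case.
Qed.

Lemma posterior_pooled v : pooled c v -> pool_posterior P k2 c (s v) = pool_prior P c.
Proof. by move=> Zv; rewrite pool_bid_pooled// /pool_posterior eqxx. Qed.

Lemma posterior_separating v : 0 <= v <= 1 -> ~~ pooled c v ->
  pool_posterior P k2 c (s v) = \d_(v : measurableTypeR R).
Proof.
move=> v01 Zv; rewrite /pool_posterior pool_bid_eq0// (negbTE Zv).
by rewrite pool_type_separating.
Qed.

Lemma posteriorE v (B : set (measurableTypeR R)) : 0 <= v <= 1 ->
  pool_posterior P k2 c (s v) B =
  if pooled c v then pool_prior P c B else (\1_B v)%:E.
Proof.
move=> v01; have [Zv|Zv] := boolP (pooled c v); first by rewrite posterior_pooled.
by rewrite posterior_separating.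
Qed.

Lemma posterior_unit v : 0 <= v <= 1 -> pool_posterior P k2 c (s v) unit_itv = 1%E.
Proof.
move=> v01; rewrite posteriorE//; case: ifP => _; first exact: pool_prior_unit.
by rewrite indicE mem_set.
Qed.

Lemma dirac1_unit :
  \d_(1 : measurableTypeR R) (unit_itv : set (measurableTypeR R)) = 1%E :> \bar R.
Proof. by rewrite diracE mem_set// /unit_itv/= in_itv/= ler01 lexx. Qed.

Lemma pool_feasible_beliefs : feasible_beliefs a.
Proof.
split=> [b0 b1 b00 b10|i v b b' v01 b0 b'0] /=; last first.
  by case: ifP => _; [exact: pool_prior_unit|exact: dirac1_unit].
rewrite /pool_belief; case: ifPn => [/asboolP[[v v01 ->] [w w01 ->]]|_].
  rewrite [LHS]product_measure1E; try exact: measurable_unit_itv.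
  by rewrite [X in (X * _)%E]posterior_unit// [X in (_ * X)%E]posterior_unit// mule1.
rewrite /= diracE mem_set//; split; rewrite /unit_itv/= in_itv/=.
  by case: ifP => _ /=; rewrite lexx ler01.
by case: ifP => _ /=; rewrite lexx ler01.
Qed.

Lemma measurable_low_types m :
  measurable (unit_itv `&` [set w | k2 * w <= m] : set (measurableTypeR R)).
Proof.
apply: measurableI; first exact: measurable_unit_itv.
have mf : measurable_fun setT ((fun w => k2 * w <= m) : measurableTypeR R -> bool).
  by apply: measurable_fun_ler => //; exact: measurable_funM.
by have := mf measurableT [set true] I; rewrite setTI.
Qed.

(* With [m] the revenue from stopping, the proposer is certain that continuing
   cannot pay more, even if both builders bid their values. *)
Lemma posterior_revenue v m : 0 <= v <= 1 -> s v <= m ->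
  (exists2 u, 0 <= u <= 1 /\ ~~ pooled c u & s u <= m) ->
  pool_posterior P k2 c (s v) (unit_itv `&` [set w | k2 * w <= m]) = 1%E.
Proof.
move=> v01 sm [u [u01 Zu] um]; rewrite posteriorE//; case: ifPn => [Zv|Zv].
  have [cu _ clt1] := unpooledP c hc u u01 Zu.
  have mS := measurable_low_types m.
  apply/eqP; rewrite eq_le probability_le1//=.
  rewrite -(pool_prior_carrier P c hP hc); apply: le_measure; rewrite ?inE//.
    exact: measurable_pool_set.
  move=> w [w01 Zw]; split=> //=; apply: le_trans um.
  apply: le_trans (pool_bid_ge_k2 P k2 c hP hc u (hadm clt1) u01 Zu).
  by apply: ler_wpM2l => //; apply: le_trans cu; exact: pooled_le.
rewrite indicE mem_set//; split=> //=; apply: le_trans sm.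
have [_ _ clt1] := unpooledP c hc v v01 Zv.
exact: (pool_bid_ge_k2 P k2 c hP hc v (hadm clt1)).
Qed.

Definition ctn_max b b' (x : measurableTypeR R * measurableTypeR R) : R :=
  k2 * Num.max (bid x.1 b b') (bid x.2 b' b).

Lemma measurable_ctn_max b b' (D : set (measurableTypeR R * measurableTypeR R)) :
  measurable D -> measurable_fun D (fun y => (ctn_max b b' y)%:E).
Proof.
move=> mD; apply/measurable_EFinP; apply: measurable_funTS.
apply: measurable_funM => //; apply: measurable_maxr;
  by apply: measurable_pool_bid2.
Qed.

Lemma measurable_unit_square :
  measurable (unit_itv `*` unit_itv : set (measurableTypeR R * measurableTypeR R)).
Proof. by apply: measurableX; exact: measurable_unit_itv. Qed.

Lemma ctn_max_ge0 b b' (x : measurableTypeR R * measurableTypeR R) :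
  0 <= b -> (unit_itv `*` unit_itv) x -> 0 <= ctn_max b b' x.
Proof.
move=> b0 [x1 _]; rewrite mulr_ge0// le_max (le_trans b0)//.
by apply: pool_bid2_ge => //; move: x1; rewrite /unit_itv/= in_itv.
Qed.

Lemma ctn_max_le b b' (x : measurableTypeR R * measurableTypeR R) :
  0 <= b -> 0 <= b' -> pool_stop d b b' ->
  k2 * x.1 <= Num.max b b' -> k2 * x.2 <= Num.max b b' ->
  ctn_max b b' x <= Num.max b b'.
Proof.
move=> b0 b'0 /andP[m0 _] h1 h2; have := k0; have := k1.
have nz : ~~ ((b == 0) && (b' == 0)).
  by apply/negP => /andP[/eqP bE /eqP b'E]; move: m0; rewrite bE b'E maxxx ltxx.
rewrite /ctn_max /pool_bid2 !andbA [(b' == 0) && _]andbC (negbTE nz)/=.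
rewrite !maxr_pMr// => _ _.
have bm : k2 * b <= Num.max b b' by rewrite le_max ler_piMl.
have bm' : k2 * b' <= Num.max b b' by rewrite le_max orbC ler_piMl.
by rewrite !ge_max bm bm' h1 h2.
Qed.

Lemma integral_unit_square_dirac (x : measurableTypeR R * measurableTypeR R) b b' :
  (unit_itv `*` unit_itv) x ->
  (\int[\d_x]_(y in unit_itv `*` unit_itv) (ctn_max b b' y)%:E)%E = (ctn_max b b' x)%:E.
Proof.
move=> xU; rewrite integral_dirac; first by rewrite diracE mem_set// mul1e.
- exact: measurable_unit_square.
- by apply: measurable_ctn_max; exact: measurable_unit_square.
Qed.

Lemma pool_proposer_rational : proposer_rational k2 a.
Proof.
move=> b b' b0 b'0 /=; rewrite /ctn_revenue /=; have [stop|ctn] := ifPn; last first.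
  have [m0|m0] := leP (Num.max b b') 0.
    apply: (@le_trans _ _ 0%E); first by rewrite lee_fin.
    by apply: integral_ge0 => x xU; rewrite lee_fin; exact: (ctn_max_ge0 b b').
  have md : Num.max b b' < d by move: ctn; rewrite /pool_stop m0/= -ltNge.
  (* A history whose highest bid is positive but below [d] is off path, since positive on-path bids
     are at least [d]. *)
  rewrite /pool_belief ifN; last first.
    apply/asboolPn => -[[v v01 bE] [w w01 b'E]].
    have Zv : pooled c v.
      apply: contraLR md => Zv; rewrite -leNgt le_max bE.
      by rewrite (dF_le_pool_bid P k2 c).
    have Zw : pooled c w.
      apply: contraLR md => Zw; rewrite -leNgt le_max b'E.
      by rewrite (dF_le_pool_bid P k2 c) ?orbT.
    by move: m0; rewrite bE b'E !pool_bid_pooled// maxxx ltxx.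
  rewrite (negbTE ctn) (integral_unit_square_dirac (1, 1)); last first.
    by split; rewrite /unit_itv/= in_itv/= lexx ler01.
  rewrite lee_fin (le_trans (ltW md))// (le_trans hd)// /ctn_max /= -[X in X <= _]mulr1.
  apply: ler_wpM2l => //; rewrite le_max /pool_bid2 ifN ?le_max ?lexx ?orbT//.
  by apply/negP => /and3P[/eqP bE /eqP b'E _]; move: m0; rewrite bE b'E maxxx ltxx.
set m := Num.max b b'.
rewrite /pool_belief; case: ifPn => [/asboolP[[v v01 bE] [w w01 b'E]]|_]; last first.
  rewrite stop (integral_unit_square_dirac (0, 0)); last first.
    by split; rewrite /unit_itv/= in_itv/= lexx ler01.
  rewrite lee_fin; apply: ctn_max_le => //=; rewrite mulr0.
    by rewrite le_max b0.
  by rewrite le_max b0.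
(* A positive on-path history reveals at least one separating type [u >= c]; it also bounds the
   value of a rival who may be pooled. *)
have ex_u : exists2 u, 0 <= u <= 1 /\ ~~ pooled c u & s u <= m.
  have [Zv|Zv] := boolP (pooled c v); last by exists v => //; rewrite /m bE le_max lexx.
  have [Zw|Zw] := boolP (pooled c w).
    by move: stop; rewrite /pool_stop bE b'E !pool_bid_pooled// maxxx ltxx.
  by exists w => //; rewrite /m b'E le_max lexx orbT.
pose S : set (measurableTypeR R) := unit_itv `&` [set w | k2 * w <= m].
have mS : measurable S by exact: measurable_low_types.
have Q1 : pool_posterior P k2 c b S = 1%E.
  by rewrite bE; apply: posterior_revenue => //; rewrite /m bE le_max lexx.
have Q2 : pool_posterior P k2 c b' S = 1%E.
  by rewrite b'E; apply: posterior_revenue => //; rewrite /m b'E le_max lexx orbT.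
set Q : probability _ R := (_ \x _)%E.
have QS : Q (S `*` S) = 1%E.
  rewrite [LHS]product_measure1E//.
  by rewrite [X in (X * _)%E]Q1 [X in (_ * X)%E]Q2 mule1.
have mSS : measurable (S `*` S) by exact: measurableX.
have QSC : Q (~` (S `*` S)) = 0%E by rewrite probability_setC// QS subee.
have mU := measurable_unit_square.
(* The revenue is below [m] only on [S * S], so the comparison is almost sure under the belief. *)
apply: (@le_trans _ _ (\int[Q]_(x in unit_itv `*` unit_itv) (cst m%:E x))%E).
  apply: ae_ge0_le_integral => //.
  - by move=> x xU; rewrite lee_fin; exact: (ctn_max_ge0 b b').
  - exact: measurable_ctn_max.
  - by move=> x _; rewrite lee_fin /m le_max b0.
  exists (~` (S `*` S)); split; [exact: measurableC|exact: QSC|].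
  move=> x /= nx [[_ x1] [_ x2]]; apply: nx => _.
  by rewrite lee_fin; apply: ctn_max_le.
rewrite integral_cst// -[leRHS]mule1 lee_wpmul2l//.
  by rewrite lee_fin /m le_max b0.
exact: probability_le1.
Qed.

(** * Consistency with Bayes' rule *)

Lemma pool_bayes_posterior : bayes_posterior P s (pool_posterior P k2 c).
Proof.
have mU := @measurable_unit_itv R.
have mZ := @measurable_pooled R c.
have ms := @measurable_pool_bid R P k2 c.
split.
- move=> B mB.
  apply: (eq_measurable_fun
    (fun v => if pooled c v then pool_prior P c B else (\1_B v)%:E)).
    move=> v; rewrite inE /unit_itv/= in_itv/= => v01; by rewrite posteriorE.
  apply: measurable_funTS; apply: measurable_fun_ifT => //.
  by apply/measurable_EFinP; exact: measurable_indic.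
- move=> B C mB mC.
  have msC : measurable (s @^-1` C : set (measurableTypeR R)).
    by rewrite -[_ @^-1` _]setTI; exact: ms.
  have mPool := measurable_pool_set c.
  have mUC : measurable (unit_itv `&` s @^-1` C : set (measurableTypeR R)).
    exact: measurableI.
  set D := unit_itv `&` s @^-1` C.
  have mDZ : measurable (D `&` pool_set c) by exact: measurableI.
  have mDn : measurable (D `&` ~` pool_set c).
    by apply: measurableI => //; exact: measurableC.
  have DE : D = (D `&` pool_set c) `|` (D `&` ~` pool_set c).
    by rewrite -setIUr setUv setIT.
  have disj : (D `&` pool_set c) `&` (D `&` ~` pool_set c) = set0.
    by rewrite setIACA setICr setI0.
  have eqf v : D v -> pool_posterior P k2 c (s v) B =
      if pooled c v then pool_prior P c B else (\1_B v)%:E.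
    by case=> + _; rewrite /unit_itv/= in_itv/=; exact: posteriorE.
  have -> : (\int[P]_(v in D) pool_posterior P k2 c (s v) B =
      \int[P]_(v in D) if pooled c v then pool_prior P c B else (\1_B v)%:E)%E.
    by apply: eq_integral => v; rewrite inE; exact: eqf.
  rewrite [in RHS]DE ge0_integral_setU//; last 3 first.
  + rewrite -DE; apply: measurable_funTS; apply: measurable_fun_ifT => //.
    by apply/measurable_EFinP; exact: measurable_indic.
  + by move=> v _; case: ifP => _ //; rewrite lee_fin.
  + by apply/eqP.
  (* On the pool the posterior is constant; off the pool the bid reveals the type and the posterior
     is an indicator. *)
  have -> : (\int[P]_(v in D `&` pool_set c)
      (if pooled c v then pool_prior P c B else (\1_B v)%:E) =
      pool_prior P c B * P (D `&` pool_set c))%E.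
    rewrite -integral_cst//; apply: eq_integral => v; rewrite inE => -[_ [_ Zv]].
    by rewrite ifT.
  have -> : (\int[P]_(v in D `&` ~` pool_set c)
      (if pooled c v then pool_prior P c B else (\1_B v)%:E) =
      P (B `&` (D `&` ~` pool_set c)))%E.
    rewrite -integral_indic//; apply: eq_integral => v; rewrite inE => -[[v01 _] nZ].
    by rewrite ifF//; apply/negP => Zv; apply: nZ.
  have -> : unit_itv `&` B `&` s @^-1` C = B `&` D by rewrite /D setIAC setIC.
  rewrite [in LHS]DE setIUr measureU//; try exact: measurableI; last first.
    by rewrite setIACA disj setI0.
  congr (_ + _)%E.
  (* All pooled types bid 0, so [C] catches either the whole pool or none of it. *)
  have [C0|C0] := pselect (C 0).
    have -> : D `&` pool_set c = pool_set c.
      apply/seteqP; split=> v; [by case|move=> [v01 Zv]].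
      by split=> //; split=> //=; rewrite pool_bid_pooled.
    (* For [c = 0] the pool is null and both sides vanish, whatever the posterior after a zero
       bid. *)
    have [ce0|cn0] := eqVneq c 0.
      have PZ : P (pool_set c) = 0%E by rewrite prior_pool// ce0 cdfF0.
      rewrite PZ mule0; apply/eqP; rewrite eq_le measure_ge0 andbT -PZ.
      by apply: le_measure; rewrite ?inE//; exact: measurableI.
    have cpos : 0 < c by rewrite lt_def cn0.
    have Fc : 0 < F c by apply: (cdfF_gt0 P hP); rewrite cpos.
    rewrite pool_priorE// prior_pool// -muleA -EFinM mulVf ?mule1//.
    by rewrite gt_eqF.
  have -> : D `&` pool_set c = set0.
    apply/seteqP; split=> v //= -[[_ +] [_ Zv]] /=.
    by rewrite /preimage/= pool_bid_pooled.
  by rewrite setI0 !measure0 mule0.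
- move=> v v01; rewrite posteriorE//; case: ifPn => [Zv|Zv]; last first.
    by rewrite indicE mem_set.
  rewrite -[RHS](pool_prior_carrier P c hP hc); congr (pool_prior P c _).
  rewrite pool_bid_pooled//; apply/seteqP; split => w [w01] /=.
    by move/eqP; rewrite pool_bid_eq0 => // Zw; split.
  by move=> Zw; split=> //=; rewrite pool_bid_pooled.
Qed.

(** A separating bid on either side makes the proposer stop, so the on-path stage-2 information sets
    are those of two pooled builders, where the belief is [pool_prior]. *)
Lemma pool_bayes_on_path : bayes_on_path P a.
Proof.
exists (fun _ => pool_posterior P k2 c); split.
- by move=> i; exact: pool_bayes_posterior.
- move=> b b' on0 on1 B C mB mC /=; rewrite /pool_belief ifT; last exact/asboolP.
  exact: product_measure1E.
- move=> i v b' v01 [w w01 /= ->]; rewrite pool_stopC => ctn B mB.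
  have Zw : pooled c w by apply: contraNT ctn; exact: pool_stop_unpooled.
  have Zv : pooled c v.
    by apply: contraNT ctn => Zv; rewrite /pool_stop maxC; exact: pool_stop_unpooled.
  by rewrite !pool_bid_pooled// !eqxx Zv /= /pool_posterior eqxx.
Qed.

Lemma pool_uni_pooling_PBE : uni_pooling_PBE P k2 a c.
Proof.
split; [split| |].
- exact: pool_feasible.
- by split; [exact: pool_stage1_rational|exact: pool_proposer_rational|
             exact: pool_stage2_rational].
- exact: pool_feasible_beliefs.
- exact: pool_bayes_on_path.
- exact: pool_symmetric.
- by move=> i; exact: pool_bid_regular.
Qed.


End Assessment.

(** * The standard auction and the conclusion *)

(** Both sides are compared with [A v]: beating all lower types secures it, and the convexity
    inequality caps every deviation by it. *)
Lemma fpa_bid_equilibrium {R : realType} (P : probability (measurableTypeR R) R)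
  (hP : value_distribution P) : fpa_equilibrium P (fpa_bid P).
Proof.
have mW x : measurable_fun setT
    ((fun w => win x (fpa_bid P w)) : measurableTypeR R -> R).
  by apply: measurable_win => //; exact: measurable_fpa_bid.
have W0 x w : 0 <= win x (fpa_bid P w) by exact: win_ge0.
have W1 x w : win x (fpa_bid P w) <= 1 by exact: win_le1.
split.
- by apply: measurable_funTS; exact: measurable_fpa_bid.
- by move=> v; exact: fpa_bid_ge0.
move=> v x v01 x0; have /andP[v0 v1] := v01.
rewrite /fpa_payoff !integral_scaleE// lee_fin.
have Av : 0 <= AF P v by exact: AF_ge0.
apply: (@le_trans _ _ (AF P v)).
  apply: payoff_le => //.
    by move=> t /andP[t0 t1]; apply: cdfF_surj => //; rewrite !ltW.
  move=> w w' w0 ww' w'1 Aw; apply: win_gt; rewrite ltNge; apply/negP => bx.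
  have w'0 : 0 <= w' by exact: le_trans (ltW ww').
  have Fw := cdfF_ge0 P w.
  have vx : 0 < v - x by rewrite ltNge; apply/negP => vx; nra.
  have : (v - x) * cdfF P w <= (v - w') * cdfF P w' + AF P w'.
    apply: fpa_deviation => //; first by rewrite w'0.
      by rewrite -subr_ge0 ltW.
    by rewrite Fw; apply: cdfF_homo; exact: ltW.
  by have := AF_convex P w' v w'0 v0; lra.
rewrite -(fpa_bid_rent P hP v v01).
apply: ler_wpM2l; first by rewrite subr_ge0 fpa_bid_le.
apply: cdfF_le_expectation => //; [exact: prior_unit|exact: prior_atomless|].
by move=> w /andP[w0 wv]; rewrite win_lt//; exact: fpa_bid_lt.
Qed.

Lemma sF_pool_bid {R : realType} (P : probability (measurableTypeR R) R)
  (k2 c v : R) : c < 1 -> sF P k2 c v = pool_bid P k2 c v.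
Proof. by move=> c1; rewrite /sF /pool_bid /pooled (lt_eqF c1) orbF. Qed.

Theorem theorem2 (R : realType) (P : probability (measurableTypeR R) R)
    (k2 : R) (hP : value_distribution P) (hk2 : 0 <= k2 <= 1) :
  (exists (c : R) (a : assessment R), uni_pooling_PBE P k2 a c) /\
  (k2 < Kplus P ->
     (exists c : R, admissible_cutoff P k2 c) /\
     (forall c : R, admissible_cutoff P k2 c ->
        exists a : assessment R,
          [/\ uni_pooling_PBE P k2 a c,
              forall (i : bool) (v : R), 0 <= v <= 1 ->
                bid1 a i v = sF P k2 c v,
              ~~ stop a 0 0
            & forall v w : R, 0 <= v <= 1 -> 0 <= w <= 1 ->
                0 < bid1 a false v \/ 0 < bid1 a true w ->
                stop a (bid1 a false v) (bid1 a true w)])) /\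
  (Kplus P <= k2 ->
     exists a : assessment R,
       [/\ uni_pooling_PBE P k2 a 1,
           forall (i : bool) (v : R), 0 <= v <= 1 -> bid1 a i v = 0,
           ~~ stop a 0 0,
           forall (i : bool) (v : R), 0 <= v <= 1 ->
             (forall A : set (measurableTypeR R), measurable A ->
                builder_belief a i v 0 0 A = P A) /\
             bid2 a i v 0 0 = fpa_bid P v
         & forall i : bool, fpa_equilibrium P (fun v : R => bid2 a i v 0 0)]).
Proof.
have stop00 c : ~~ stop (pool_assessment P k2 c) 0 0.
  by rewrite /= /pool_stop maxxx ltxx.
have adm c : admissible_cutoff P k2 c ->
    uni_pooling_PBE P k2 (pool_assessment P k2 c) c.
  move=> [/andP[c0 c1] hA hd].
  by apply: pool_uni_pooling_PBE => //; rewrite c0 ltW.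
have full : Kplus P <= k2 -> uni_pooling_PBE P k2 (pool_assessment P k2 1) 1.
  rewrite Kplus_le => hK; apply: pool_uni_pooling_PBE => //.
  - by rewrite ler01 lexx.
  - by rewrite dF1//; lra.
  - by rewrite ltxx.
have pooled1 v : pooled 1 v by rewrite /pooled eqxx !orbT.
split; [|split].
- have [/full|/(admissible_cutoff_ex P hP k2 hk2)[c /adm]] := leP (Kplus P) k2.
    by move=> ?; exists 1, (pool_assessment P k2 1).
  by move=> ?; exists c, (pool_assessment P k2 c).
- move=> kK; split; first exact: admissible_cutoff_ex.
  move=> c hadm; have [/andP[c0 c1] _ _] := hadm.
  have hc : 0 <= c <= 1 by rewrite c0 ltW.
  exists (pool_assessment P k2 c); split => //; first exact: adm.
    by move=> i v v01; rewrite sF_pool_bid.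
  move=> v w v01 w01 /= [] pos.
    rewrite /pool_stop maxC; apply: pool_stop_unpooled => //.
    by rewrite -(pool_bid_eq0 P k2 c hP hk2 hc v v01) gt_eqF.
  apply: pool_stop_unpooled => //.
  by rewrite -(pool_bid_eq0 P k2 c hP hk2 hc w w01) gt_eqF.
- move=> hK; exists (pool_assessment P k2 1); split => //.
  + exact: full.
  + by move=> i v _; exact: pool_bid_pooled.
  + move=> i v v01; rewrite /= /pool_bid2 !eqxx pooled1/=; split=> // B mB.
    by apply: pool_prior1 => //; rewrite ler01 lexx.
  + move=> i; have -> : (fun v => bid2 (pool_assessment P k2 1) i v 0 0) = fpa_bid P.
      by apply/funext => v; rewrite /= /pool_bid2 !eqxx pooled1.
    exact: fpa_bid_equilibrium.
Qed.
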